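(* Let $L$ be a Lie algebra in $\mathrm{Ver}_4^+$ whose underlying object is $\mathbf 1+P$, with basis $x,y,y'$ where $dx=0$ and $y'=dy$. Then $L$ is isomorphic to exactly one of the following Lie algebras, which are organized by their subalgebras and quotients. Here $\lambda\in k$ is a parameter taking arbitrary values. For each algebra, ''Sub'' indicates which Lie algebra structures on $P$ and $\mathbf 1^2=2\cdot\mathbf 1$ appear as subalgebras of $L$, and ''Quot'' likewise for quotients of $L$ (in some rows $\mathbf 1$ is also listed). 1. $[x,y']=0$, $[y,y]=0$, $[y',y]=0$, $[x,y]=0$. Sub: $\mathbf 1,\mathbf 1^2,P_a$. Quot: $\mathbf 1,\mathbf 1^2,P_a$. 2. $[x,y']=y'$, $[y,y]=0$, $[y',y]=0$, $[x,y]=y+\lambda y'$. Sub: $L_2,P_a,P_s$. Quot: $L_2$. 3. $[x,y']=0$, $[y,y]=y'$, $[y',y]=0$, $[x,y]=\lambda x$. Sub: $\mathbf 1^2,P_n$. Quot: $P_n,L_2,\mathbf 1$. 4. $[x,y']=0$, $[y,y]=y'$, $[y',y]=0$, $[x,y]=y'$. Sub: $\mathbf 1^2,P_n$. Quot: $\mathbf 1^2,\mathbf 1$. 5. $[x,y']=0$, $[y,y]=x$, $[y',y]=\lambda x$, $[x,y]=0$. Sub: $\mathbf 1^2$. Quot: $P_a,\mathbf 1$. 6. $[x,y']=0$, $[y,y]=x$, $[y',y]=\lambda x+y'$, $[x,y]=0$. Sub: $\mathbf 1^2$. Quot: $\mathbf 1$, $P_s$, $\mathbf 1^2$ if $\lambda=0$,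 $P_n$ if $\lambda\ne0$. 7. $[x,y']=0$, $[y,y]=0$, $[y',y]=0$, $[x,y]=x$. Sub: $\mathbf 1^2,P_a$. Quot: $P_a,L_2,\mathbf 1$. 8. $[x,y']=0$, $[y,y]=0$, $[y',y]=0$, $[x,y]=y'$. Sub: $\mathbf 1^2,P_a$. Quot: $\mathbf 1^2,\mathbf 1$. 9. $[x,y']=0$, $[y,y]=0$, $[y',y]=y'$, $[x,y]=x+y'$. Sub: $\mathbf 1^2,P_s$. Quot: $L_2,\mathbf 1$. 10. $[x,y']=0$, $[y,y]=0$, $[y',y]=y'$, $[x,y]=\lambda x$. Sub: $\mathbf 1^2,P_s$. Quot: $L_2,P_s,\mathbf 1$. 11. $[x,y']=0$, $[y,y]=0$, $[y',y]=x$, $[x,y]=x+\lambda y'$. Sub: $\mathbf 1^2$. Quot: $\mathbf 1$, $P_s$, $P_a$ if $\lambda=0$. 12. $[x,y']=0$, $[y,y]=0$, $[y',y]=x$, $[x,y]=y'$. Sub: $\mathbf 1^2$. Quot: $\mathbf 1,P_s$. 13. $[x,y']=0$, $[y,y]=0$, $[y',y]=x$, $[x,y]=0$. Sub: $\mathbf 1^2,\mathbf 1$. Quot: $P_a$.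
   Context: Let $k$ be an algebraically closed field of characteristic $2$. $\mathrm{Ver}_4^+$ is the symmetric tensor category whose objects are finite-dimensional $k$-vector spaces $V$ with a linear endomorphism $d$, $d^2=0$ (write $x'=dx$), morphisms are linear maps commuting with $d$, $d$ acts on tensor products by $d\otimes1+1\otimes d$, and the braiding is $c(v\otimes w)=w\otimes v+w'\otimes v'$. $\mathbf 1$ is the one-dimensional object with $d=0$; $P$ is the two-dimensional object $k[d]/d^2$. A Lie algebra in $\mathrm{Ver}_4^+$ is an object with a bilinear bracket $[\cdot,\cdot]$ satisfying $d[x,y]=[x',y]+[x,y']$; $[x,y]+[y,x]+[y',x']=0$; $[[x,y],z]+[[z,x],y]+[[y,z],x]+[[x',y],z']+[[z',x],y']+[[y',z],x']=0$; and $[x,x]=0$ whenever $x'=0$. For underlying object $\mathbf 1+P$ with basis $x,y,y'$ as in the claim, these axioms force $[x,x]=[y',y']=0$ and $[u,v]=[v,u]$ for all $u,v$, so the four listed brackets determine the structure. Isomorphisms are linear bijections commuting with $d$ and preserving the bracket. Notation for the small Lie algebras: $\mathbf 1$ and $\mathbf 1^2$ denote the abelian Lie algebras on the objects $\mathbf 1$ and $2\cdot\mathbf 1$. $L_2$ is the Lie algebra on $2\cdot\mathbf 1$ with basis $u,v$ and $[u,v]=u$. On $P$ with basis $u,u'$: $P_a$ is the abelian Lie algebra; $P_s$ has $[u,u]=0$, $[u',u]=u'$; $P_n$ has $[u,u]=u'$, $[u',u]=0$.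
   Formalization: The Quot lists are corrected at λ=0, where the printed ones are false: in rows 3 and 10, L_2 becomes 1^2; in row 5, P_n is added (quotient by x+y'); in row 6, 1^2 is removed (modulo y' one has [y,y]=x≠0). *)

(* Defs.v *)
From HB Require Import structures.
From mathcomp Require Import all_boot all_order all_algebra.
From mathcomp Require Import ring.

Set Implicit Arguments.
Unset Strict Implicit.
Unset Printing Implicit Defensive.

Import GRing.Theory.
Local Open Scope ring_scope.

(* Ver_4^+: the symmetric tensor category of spaces with d^2 = 0 and braiding
   v (x) w |-> w (x) v + w' (x) v', where v' = d v.  The braiding enters below
   through the primed terms of [br_anti] and [br_jacobi]. *)
Record ver4 (k : fieldType) := Ver4 {
  v4_sort :> vectType k;
  v4_d : {linear v4_sort -> v4_sort};
  v4_dd : forall v, v4_d (v4_d v) = 0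
}.

Definition v4_morph (k : fieldType) (V W : ver4 k) (f : {linear V -> W}) : Prop :=
  forall v, f (v4_d V v) = v4_d W (f v).

Definition v4_iso (k : fieldType) (V W : ver4 k) : Prop :=
  exists f : {linear V -> W}, v4_morph f /\ bijective f.

Record lieAlg (k : fieldType) := LieAlg {
  la_obj :> ver4 k;
  br : la_obj -> la_obj -> la_obj;
  br_linl : forall w, linear (br^~ w);
  br_linr : forall u, linear (br u);
  br_d : forall u v, v4_d la_obj (br u v)
                     = br (v4_d la_obj u) v + br u (v4_d la_obj v);
  br_anti : forall u v,
    br u v + br v u + br (v4_d la_obj v) (v4_d la_obj u) = 0;
  br_jacobi : forall u v w,
    br (br u v) w + br (br w u) v + br (br v w) u
    + br (br (v4_d la_obj u) v) (v4_d la_obj w)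
    + br (br (v4_d la_obj w) u) (v4_d la_obj v)
    + br (br (v4_d la_obj v) w) (v4_d la_obj u) = 0;
  br_alt : forall u, v4_d la_obj u = 0 -> br u u = 0
}.

Definition lie_morph (k : fieldType) (A B : lieAlg k) (f : {linear A -> B}) : Prop :=
  v4_morph f /\ forall u v, f (br u v) = br (f u) (f v).

Definition lie_iso (k : fieldType) (A B : lieAlg k) : Prop :=
  exists f : {linear A -> B}, lie_morph f /\ bijective f.

(* Subalgebras and quotients up to isomorphism, i.e. as subobjects and quotient
   objects.  The target of a quotient map is a Lie algebra in Ver_4^+: it has to
   satisfy [br_alt], which L / I does not inherit from L for every ideal I. *)
Definition is_subalg (k : fieldType) (L A : lieAlg k) : Prop :=
  exists f : {linear A -> L}, lie_morph f /\ injective f.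

Definition is_quot (k : fieldType) (L A : lieAlg k) : Prop :=
  exists f : {linear L -> A}, lie_morph f /\ forall a, exists u, f u = a.

Definition zero_d (k : fieldType) (V : vectType k) : V -> V := fun _ => 0.

Lemma zero_d_linear (k : fieldType) (V : vectType k) : linear (@zero_d k V).
Proof. by move=> a u v; rewrite /zero_d scaler0 addr0. Qed.

HB.instance Definition _ (k : fieldType) (V : vectType k) :=
  GRing.isLinear.Build k V V *:%R (@zero_d k V) (@zero_d_linear k V).

Definition oneO (k : fieldType) : ver4 k :=
  @Ver4 k (k^o : vectType k) (@zero_d k (k^o : vectType k)) (fun=> erefl).

(* P = k[d]/d^2, the pair (a, b) standing for a + b d. *)
Definition P_d (k : fieldType) : k^o * k^o -> k^o * k^o := fun p => (0, p.1).

Lemma P_d_linear (k : fieldType) : linear (@P_d k).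
Proof.
move=> a [u1 u2] [v1 v2]; rewrite /P_d; apply: injective_projections => //=.
by rewrite scaler0 addr0.
Qed.

HB.instance Definition _ (k : fieldType) :=
  GRing.isLinear.Build k (k^o * k^o)%type (k^o * k^o)%type *:%R (@P_d k) (@P_d_linear k).

Definition PO (k : fieldType) : ver4 k :=
  @Ver4 k ((k^o * k^o)%type : vectType k) (@P_d k) (fun=> erefl).

Definition sum_d (k : fieldType) (V W : ver4 k) : V * W -> V * W :=
  fun p => (v4_d V p.1, v4_d W p.2).

Lemma sum_d_linear (k : fieldType) (V W : ver4 k) : linear (@sum_d k V W).
Proof. by move=> a u v; rewrite /sum_d /= !linearP. Qed.

HB.instance Definition _ (k : fieldType) (V W : ver4 k) :=
  GRing.isLinear.Build k (V * W)%type (V * W)%type *:%R (@sum_d k V W)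
    (@sum_d_linear k V W).

Lemma sum_dd (k : fieldType) (V W : ver4 k) (p : V * W) : sum_d (sum_d p) = 0.
Proof. by rewrite /sum_d /= !v4_dd. Qed.

Definition sumO (k : fieldType) (V W : ver4 k) : ver4 k :=
  @Ver4 k ((V * W)%type : vectType k) (@sum_d k V W) (@sum_dd k V W).

(* [ring: h2 h4 h6] only uses monomial hypotheses with these exact coefficients;
   the factor t makes 2 = 0 such a hypothesis. *)
Lemma char2_eq (k : fieldType) (hk : 2%N \in [pchar k]) (a b : k) :
  (forall t : k, t * 2 = 0 -> t * 4 = 0 -> t * 6 = 0 -> t * a = t * b) -> a = b.
Proof.
move=> h; rewrite -[a]mul1r -[b]mul1r; have h2 : 2 = 0 :> k := pcharf0 hk.
by apply: h; rewrite mul1r // ?(natrM k 2 2) ?(natrM k 2 3) h2 mul0r.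
Qed.

Definition zero_br (k : fieldType) (V : ver4 k) : V -> V -> V := fun _ _ => 0.

Lemma zero_br_linl (k : fieldType) (V : ver4 k) (w : V) : linear ((@zero_br k V)^~ w).
Proof. by move=> a u v; rewrite /zero_br scaler0 addr0. Qed.

Lemma zero_br_linr (k : fieldType) (V : ver4 k) (u : V) : linear (zero_br u).
Proof. by move=> a v w; rewrite /zero_br scaler0 addr0. Qed.

Lemma zero_br_d (k : fieldType) (V : ver4 k) (u v : V) :
  v4_d V (zero_br u v) = zero_br (v4_d V u) v + zero_br u (v4_d V v).
Proof. by rewrite /zero_br linear0 addr0. Qed.

Lemma zero_br_anti (k : fieldType) (V : ver4 k) (u v : V) :
  zero_br u v + zero_br v u + zero_br (v4_d V v) (v4_d V u) = 0.
Proof. by rewrite /zero_br !addr0. Qed.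

Lemma zero_br_jacobi (k : fieldType) (V : ver4 k) (u v w : V) :
  zero_br (zero_br u v) w + zero_br (zero_br w u) v + zero_br (zero_br v w) u
  + zero_br (zero_br (v4_d V u) v) (v4_d V w)
  + zero_br (zero_br (v4_d V w) u) (v4_d V v)
  + zero_br (zero_br (v4_d V v) w) (v4_d V u) = 0.
Proof. by rewrite /zero_br !addr0. Qed.

Definition abelA (k : fieldType) (V : ver4 k) : lieAlg k :=
  @LieAlg k V (@zero_br k V) (@zero_br_linl k V) (@zero_br_linr k V)
    (@zero_br_d k V) (@zero_br_anti k V) (@zero_br_jacobi k V)
    (fun _ _ => erefl).

(* [u, v] = u with u = (1, 0), v = (0, 1). *)
Definition L2_br (k : fieldType) (p q : k^o * k^o) : k^o * k^o :=
  (p.1 * q.2 + p.2 * q.1) *: (1, 0).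

(* The bracket on P given by [u, u] = uu and [u', u] = u'u, where u = (1, 0)
   and u' = (0, 1). *)
Definition P_br (k : fieldType) (uu u'u : k^o * k^o) (p q : k^o * k^o) : k^o * k^o :=
  (p.1 * q.1) *: uu + (p.2 * q.1 + p.1 * q.2) *: u'u.

Definition Ps_br (k : fieldType) : k^o * k^o -> k^o * k^o -> k^o * k^o :=
  P_br 0 (0, 1).

Definition Pn_br (k : fieldType) : k^o * k^o -> k^o * k^o -> k^o * k^o :=
  P_br (0, 1) 0.

Local Ltac pair_ext :=
  repeat apply: injective_projections; rewrite /= /GRing.scale /= /zero_d.

Local Ltac char2_ring hk :=
  apply: (char2_eq hk);
  let t := fresh "t" in let h2 := fresh "h2" in
  let h4 := fresh "h4" in let h6 := fresh "h6" in
  intros t h2 h4 h6; ring: h2 h4 h6.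

Definition L2A (k : fieldType) (hk : 2%N \in [pchar k]) : lieAlg k.
Proof.
apply: (@LieAlg k (sumO (oneO k) (oneO k)) (@L2_br k)).
- abstract (by move=> [w1 w2] a [u1 u2] [v1 v2]; pair_ext; ring).
- abstract (by move=> [u1 u2] a [v1 v2] [w1 w2]; pair_ext; ring).
- abstract (by move=> [u1 u2] [v1 v2]; pair_ext; ring).
- abstract (by move=> [u1 u2] [v1 v2]; pair_ext; char2_ring hk).
- abstract (by move=> [u1 u2] [v1 v2] [w1 w2]; pair_ext; char2_ring hk).
- abstract (by move=> [u1 u2] _; pair_ext; char2_ring hk).
Defined.

Definition PsA (k : fieldType) (hk : 2%N \in [pchar k]) : lieAlg k.
Proof.
apply: (@LieAlg k (PO k) (@Ps_br k)).
- abstract (by move=> [w1 w2] a [u1 u2] [v1 v2]; pair_ext; ring).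
- abstract (by move=> [u1 u2] a [v1 v2] [w1 w2]; pair_ext; ring).
- abstract (by move=> [u1 u2] [v1 v2]; pair_ext; char2_ring hk).
- abstract (by move=> [u1 u2] [v1 v2]; pair_ext; char2_ring hk).
- abstract (by move=> [u1 u2] [v1 v2] [w1 w2]; pair_ext; char2_ring hk).
- abstract (by move=> [u1 u2] [] ->; pair_ext; ring).
Defined.

Definition PnA (k : fieldType) (hk : 2%N \in [pchar k]) : lieAlg k.
Proof.
apply: (@LieAlg k (PO k) (@Pn_br k)).
- abstract (by move=> [w1 w2] a [u1 u2] [v1 v2]; pair_ext; ring).
- abstract (by move=> [u1 u2] a [v1 v2] [w1 w2]; pair_ext; ring).
- abstract (by move=> [u1 u2] [v1 v2]; pair_ext; ring).
- abstract (by move=> [u1 u2] [v1 v2]; pair_ext; char2_ring hk).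
- abstract (by move=> [u1 u2] [v1 v2] [w1 w2]; pair_ext; char2_ring hk).
- abstract (by move=> [u1 u2] [] ->; pair_ext; ring).
Defined.

Inductive small := sOne | sOne2 | sL2 | sPa | sPs | sPn.

Lemma small_comparable : comparable small.
Proof. by rewrite /comparable /decidable; decide equality. Defined.

HB.instance Definition _ := hasDecEq.Build small (compareP small_comparable).

Definition smallA (k : fieldType) (hk : 2%N \in [pchar k]) (s : small) : lieAlg k :=
  match s with
  | sOne => abelA (oneO k)
  | sOne2 => abelA (sumO (oneO k) (oneO k))
  | sL2 => L2A hk
  | sPa => abelA (PO k)
  | sPs => PsA hk
  | sPn => PnA hk
  end.

Notation onePO k := (sumO (oneO k) (PO k)).

Definition e_x (k : fieldType) : k^o * (k^o * k^o) := (1, (0, 0)).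
Definition e_y (k : fieldType) : k^o * (k^o * k^o) := (0, (1, 0)).
Definition e_y' (k : fieldType) : k^o * (k^o * k^o) := (0, (0, 1)).

Record brackets (k : fieldType) := Brackets {
  b_xy' : k^o * (k^o * k^o);
  b_yy : k^o * (k^o * k^o);
  b_y'y : k^o * (k^o * k^o);
  b_xy : k^o * (k^o * k^o)
}.

(* The bracket on 1 + P determined by the four brackets in b: it is symmetric on
   basis vectors, and [x, x] = [y', y'] = 0. *)
Definition oneP_br (k : fieldType) (b : brackets k) (u v : k^o * (k^o * k^o)) :
    k^o * (k^o * k^o) :=
  (u.1 * v.2.2 + u.2.2 * v.1) *: b_xy' b
  + (u.2.1 * v.2.1) *: b_yy b
  + (u.2.2 * v.2.1 + u.2.1 * v.2.2) *: b_y'y b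
  + (u.1 * v.2.1 + u.2.1 * v.1) *: b_xy b.

Inductive oneP_row (k : fieldType) :=
  | row1
  | row2 of k
  | row3 of k
  | row4
  | row5 of k
  | row6 of k
  | row7
  | row8
  | row9
  | row10 of k
  | row11 of k
  | row12
  | row13.

Definition row_brackets (k : fieldType) (r : oneP_row k) : brackets k :=
  let x := e_x k in let y := e_y k in let y' := e_y' k in
  match r with
  | row1    => Brackets 0  0  0            0
  | row2 l  => Brackets y' 0  0            (y + l *: y')
  | row3 l  => Brackets 0  y' 0            (l *: x)
  | row4    => Brackets 0  y' 0            y'
  | row5 l  => Brackets 0  x  (l *: x)     0
  | row6 l  => Brackets 0  x  (l *: x + y') 0
  | row7    => Brackets 0  0  0            x
  | row8    => Brackets 0  0  0            y'
  | row9    => Brackets 0  0  y'           (x + y')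
  | row10 l => Brackets 0  0  y'           (l *: x)
  | row11 l => Brackets 0  0  x            (x + l *: y')
  | row12   => Brackets 0  0  x            y'
  | row13   => Brackets 0  0  x            0
  end.

Lemma oneP_br_linl (k : fieldType) (b : brackets k) (w : onePO k) :
  linear ((oneP_br b)^~ w).
Proof.
by case: b w => ? ? ? ? [? [? ?]] a [? [? ?]] [? [? ?]]; pair_ext; ring.
Qed.

Lemma oneP_br_linr (k : fieldType) (b : brackets k) (u : onePO k) :
  linear (oneP_br b u).
Proof.
by case: b u => ? ? ? ? [? [? ?]] a [? [? ?]] [? [? ?]]; pair_ext; ring.
Qed.

Lemma oneP_br_anti (k : fieldType) (hk : 2%N \in [pchar k]) (b : brackets k)
    (u v : onePO k) :
  let B := oneP_br b in let d := v4_d (onePO k) in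
  B u v + B v u + B (d v) (d u) = 0.
Proof.
by case: b u v => ? ? ? ? [? [? ?]] [? [? ?]]; pair_ext; char2_ring hk.
Qed.

Lemma oneP_br_alt (k : fieldType) (hk : 2%N \in [pchar k]) (b : brackets k)
    (u : onePO k) : v4_d (onePO k) u = 0 -> oneP_br b u u = 0.
Proof.
by case: b u => ? ? ? ? [? [? ?]] [] ->; pair_ext; char2_ring hk.
Qed.

Lemma oneP_br_d (k : fieldType) (hk : 2%N \in [pchar k]) (b : brackets k)
    (u v : onePO k) :
  let B := oneP_br b in let d := v4_d (onePO k) in
  d (b_xy b) = b_xy' b -> d (b_yy b) = 0 -> d (b_y'y b) = 0 ->
  d (B u v) = B (d u) v + B u (d v).
Proof.
case: b u v => [? [? [? ?]] [? [? ?]] [? [? ?]]] [? [? ?]] [? [? ?]].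
by move=> /= <- [->] [->]; pair_ext; char2_ring hk.
Qed.

(* The cases where [x, y'] = 0, i.e. where the bracket takes values in the span
   of x and y'. *)
Lemma oneP_br_jacobi (k : fieldType) (hk : 2%N \in [pchar k]) (b : brackets k)
    (u v w : onePO k) :
  b_xy' b = 0 -> (b_yy b).2.1 = 0 -> (b_y'y b).2.1 = 0 -> (b_xy b).2.1 = 0 ->
  (b_yy b).1 * (b_xy b).1 = (b_yy b).2.2 * (b_y'y b).1 ->
  (b_yy b).2.2 * (b_y'y b).2.2 = (b_yy b).1 * (b_xy b).2.2 ->
  let B := oneP_br b in let d := v4_d (onePO k) in
  B (B u v) w + B (B w u) v + B (B v w) u
  + B (B (d u) v) (d w) + B (B (d w) u) (d v) + B (B (d v) w) (d u) = 0.
Proof.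
case: b u v w => [? [e [? f]] [g [? h]] [a [? c]]].
move=> [? [? ?]] [? [? ?]] [? [? ?]] /= -> -> -> -> hx hy'.
pair_ext; apply: (char2_eq hk) => t h2 h4 h6.
- by ring: h2 h4 h6 hx.
- by ring: h2 h4 h6.
- by ring: h2 h4 h6 hy'.
Qed.

Lemma row_br_d (k : fieldType) (hk : 2%N \in [pchar k]) (r : oneP_row k) (u v : onePO k) :
  let B := oneP_br (row_brackets r) in let d := v4_d (onePO k) in
  d (B u v) = B (d u) v + B u (d v).
Proof.
by apply: oneP_br_d => //; case: r => *; pair_ext; ring.
Qed.

Lemma row_br_jacobi (k : fieldType) (hk : 2%N \in [pchar k]) (r : oneP_row k)
    (u v w : onePO k) :
  let B := oneP_br (row_brackets r) in let d := v4_d (onePO k) in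
  B (B u v) w + B (B w u) v + B (B v w) u
  + B (B (d u) v) (d w) + B (B (d w) u) (d v) + B (B (d v) w) (d u) = 0.
Proof.
case: r => [|l|l||l|l||||l|l||].
2: by case: u v w => [? [? ?]] [? [? ?]] [? [? ?]]; pair_ext; char2_ring hk.
all: by apply: (oneP_br_jacobi hk) => //; pair_ext; ring.
Qed.

Definition rowA (k : fieldType) (hk : 2%N \in [pchar k]) (r : oneP_row k) : lieAlg k :=
  @LieAlg k (onePO k) (oneP_br (row_brackets r))
    (oneP_br_linl _) (oneP_br_linr _) (row_br_d hk r)
    (oneP_br_anti hk (row_brackets r)) (row_br_jacobi hk r)
    (@oneP_br_alt _ hk (row_brackets r)).

(* Listed structures on P and 2.1 are exactly those that occur, up to
   isomorphism; 1 is not listed systematically, so listing it only asserts that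
   it occurs. *)
Definition occur_exactly (k : fieldType) (hk : 2%N \in [pchar k])
    (occurs : lieAlg k -> Prop) (t : seq small) : Prop :=
  (forall s, s \in t -> occurs (smallA hk s)) /\
  (forall A : lieAlg k, v4_iso A (PO k) \/ v4_iso A (sumO (oneO k) (oneO k)) ->
     occurs A -> exists2 s, s \in t & lie_iso A (smallA hk s)).

Definition sub_table (k : fieldType) (r : oneP_row k) : seq small :=
  match r with
  | row1    => [:: sOne; sOne2; sPa]
  | row2 _  => [:: sL2; sPa; sPs]
  | row3 _  => [:: sOne2; sPn]
  | row4    => [:: sOne2; sPn]
  | row5 _  => [:: sOne2]
  | row6 _  => [:: sOne2]
  | row7    => [:: sOne2; sPa]
  | row8    => [:: sOne2; sPa]
  | row9    => [:: sOne2; sPs]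
  | row10 _ => [:: sOne2; sPs]
  | row11 _ => [:: sOne2]
  | row12   => [:: sOne2]
  | row13   => [:: sOne2; sOne]
  end.

(* Degenerate parameter l = 0: in [row3] and [row10] the quotient by y' is
   abelian (it is L_2 only for l != 0); in [row5] the line of x + y' is an ideal
   with quotient P_n; in [row6] and [row5] the bracket induced modulo y' has
   [y, y] = x with dy = 0, which violates [br_alt], so that no quotient lives
   on 2.1. *)
Definition quot_table (k : fieldType) (r : oneP_row k) : seq small :=
  match r with
  | row1    => [:: sOne; sOne2; sPa]
  | row2 _  => [:: sL2]
  | row3 l  => [:: sPn; if l == 0 then sOne2 else sL2; sOne]
  | row4    => [:: sOne2; sOne]
  | row5 l  => if l == 0 then [:: sPa; sOne; sPn] else [:: sPa; sOne]
  | row6 l  => if l == 0 then [:: sOne; sPs] else [:: sOne; sPs; sPn]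
  | row7    => [:: sPa; sL2; sOne]
  | row8    => [:: sOne2; sOne]
  | row9    => [:: sL2; sOne]
  | row10 l => [:: if l == 0 then sOne2 else sL2; sPs; sOne]
  | row11 l => if l == 0 then [:: sOne; sPs; sPa] else [:: sOne; sPs]
  | row12   => [:: sOne; sPs]
  | row13   => [:: sPa]
  end.

(* Main.v *)
Require Import Defs.
From HB Require Import structures.
From mathcomp Require Import all_boot all_order all_algebra.
From mathcomp Require Import ring.

(** A Lie algebra on 1 + P is determined by seven scalars. Compatibility with d
    forces [x, y] = a x + b y + c y', [x, y'] = b y', [y, y] = e x + f y' and
    [y', y] = g x + h y', and the Jacobi identity adds five quadratic equations
    ([onePO_bracket]). The automorphisms of the object 1 + P send
    x to al (x + tau y'), y to ga x + de y + ep y' and y' to de y', with al and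
    de nonzero, so that the isomorphism classes are the orbits of this group on
    the septuples ([lie_iso_rebase]).

    If b is nonzero, Jacobi leaves only a and c free, and a is removed by adding
    a multiple of x to y; the ratio c / b is the parameter of the second row. If
    b = 0, the bracket is encoded in the plane W spanned by x and y', namely in
    the endomorphism T = ad y of W and the vector w = [y, y] of W, with T w = 0.
    The group acts by the changes of basis of W that preserve the line of y', and
    rescaling y by de multiplies T by de and w by de ^ 2. The cases are then the
    following ones.
    - w off the line of y': take w for x; then T x = 0, and T y' tells the fifth
      row from the sixth, according to whether T y' is proportional to w;
    - w on the line of y' and y' not an eigenvector of T: take T y' for x; then T
      is a companion matrix, so that its trace and determinant up to scaling
      decide (eleventh to thirteenth rows);
    - y' an eigenvector: T is triangular with eigenvalues a on W / y' and h on y',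
      and can be diagonalised compatibly with the line of y' unless it is a
      Jordan block (the other rows; h = 0 when w is nonzero).
    This decision procedure is the function [row_of]. It is invariant under the
    group ([row_of_rebase]), it recovers the row from the constants of that row
    ([row_ofK]), and every septuple is moved to the constants of its row
    ([rebase_normal]); existence and uniqueness of the row follow.

    For subalgebras and quotients it is enough to know when each of the algebras
    on P and 2.1 in the tables occurs, since every Lie algebra on these objects
    is isomorphic to one of them ([classify_P], [classify_two]). A copy of P is
    spanned by some ga x + de y + ep y' and de y', and a copy of 2.1 is the
    kernel of d, i.e. W. Dually, a quotient on P kills a line of W other than
    that of y', say of x + s y', and a quotient on 2.1 kills y'. In each case the
    condition on the septuple is a short list of equations ([is_subalg_P],
    [is_subalg_two], [is_quot_P], [is_quot_two]), which is then evaluated on the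
    thirteen rows. *)

Set Implicit Arguments.
Unset Strict Implicit.
Unset Printing Implicit Defensive.

Import GRing.Theory.
Local Open Scope ring_scope.

(** * Arithmetic in characteristic 2 *)

Local Ltac coords := repeat apply: injective_projections; rewrite /= /GRing.scale /= /zero_d.

Lemma addr_eq0_pchar2 (k : fieldType) (hk : 2%N \in [pchar k]) (u v : k) :
  (u + v == 0) = (u == v).
Proof. by rewrite addr_eq0 (oppr_pchar2 hk). Qed.

(** An equality is turned into the vanishing of the sum of its two sides: the
    coefficients are then the even numbers 2, 4 and 6, which are the ones that
    [char2_eq] makes the ring tactic delete. *)
Local Ltac char2_ring hk :=
  apply/eqP; rewrite -(addr_eq0_pchar2 hk); apply/eqP; apply: (char2_eq hk);
  let t := fresh "t" in let h2 := fresh "h2" in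
  let h4 := fresh "h4" in let h6 := fresh "h6" in
  intros t h2 h4 h6; ring: h2 h4 h6.

(** * Isomorphisms and transport of structure *)

Definition lin (k : fieldType) (U V : lmodType k) (f : U -> V) (hf : linear f) :
  {linear U -> V} := HB.pack f (GRing.isLinear.Build k U V *:%R f hf).

Lemma lie_iso_sym (k : fieldType) (A B : lieAlg k) : lie_iso A B -> lie_iso B A.
Proof.
move=> [f [[fd fb] [g fK gK]]]; exists (lin (can2_linear fK gK)); split; last first.
  by exists f.
by split=> [v|u v]; apply: (can_inj fK); rewrite /= ?fd ?fb !gK.
Qed.

Lemma lie_morph_comp (k : fieldType) (A B C : lieAlg k)
    (f : {linear A -> B}) (g : {linear B -> C}) :
  lie_morph f -> lie_morph g -> lie_morph (g \o f : {linear A -> C}).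
Proof. by move=> [fd fb] [gd gb]; split=> [v|u v] /=; rewrite ?fd ?gd ?fb ?gb. Qed.

Lemma lie_iso_trans (k : fieldType) (A B C : lieAlg k) :
  lie_iso A B -> lie_iso B C -> lie_iso A C.
Proof.
move=> [f [fm fbij]] [g [gm gbij]]; exists (g \o f : {linear A -> C}).
by split; [exact: lie_morph_comp|exact: bij_comp].
Qed.

Lemma is_subalg_iso (k : fieldType) (L A B : lieAlg k) :
  lie_iso A B -> is_subalg L A -> is_subalg L B.
Proof.
move=> /lie_iso_sym[f [fm /bij_inj finj]] [g [gm ginj]].
exists (g \o f : {linear B -> L}).
by split; [exact: lie_morph_comp|exact: inj_comp].
Qed.

Lemma is_quot_iso (k : fieldType) (L A B : lieAlg k) :
  lie_iso A B -> is_quot L A -> is_quot L B.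
Proof.
move=> [f [fm [f' _ f'K]]] [g [gm gsurj]]; exists (f \o g : {linear L -> B}).
split=> [|b]; first exact: lie_morph_comp.
by have [u gu] := gsurj (f' b); exists u; rewrite /= gu.
Qed.

(** The carrier of a Lie algebra L on V is only propositionally equal to V for an
    abstract L. This predicate replaces that equality: eliminating it turns the
    carrier into V itself, so that elements of L become coordinate vectors. *)
Inductive has_bracket (k : fieldType) (V : ver4 k) (C : V -> V -> V) : lieAlg k -> Prop :=
  HasBracket B h1 h2 h3 h4 h5 h6 :
    B =2 C -> has_bracket C (@LieAlg k V B h1 h2 h3 h4 h5 h6).

Lemma transport (k : fieldType) (L : lieAlg k) (V : ver4 k) : v4_iso L V ->
  exists C (M : lieAlg k), has_bracket (V := V) C M /\ lie_iso L M.
Proof.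
move=> [f [fd [g fK gK]]]; have gl := can2_linear fK gK; pose g' := lin gl.
have gE v : g v = g' v by [].
have gd v : g (v4_d V v) = v4_d L (g v) by apply: (can_inj fK); rewrite fd !gK.
pose B u v := f (br (g u) (g v)).
have h1 w : linear (B^~ w).
  by move=> a u v; rewrite /B (gl a) (br_linl (g w) a) linearP.
have h2 w : linear (B w).
  by move=> a u v; rewrite /B (gl a) (br_linr (g w) a) linearP.
have h3 u v : v4_d V (B u v) = B (v4_d V u) v + B u (v4_d V v).
  by rewrite /B !gd -fd br_d linearD.
have h4 u v : B u v + B v u + B (v4_d V v) (v4_d V u) = 0.
  by rewrite /B !gd -!linearD br_anti linear0.
have h5 u v w : B (B u v) w + B (B w u) v + B (B v w) u
    + B (B (v4_d V u) v) (v4_d V w) + B (B (v4_d V w) u) (v4_d V v)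
    + B (B (v4_d V v) w) (v4_d V u) = 0.
  by rewrite /B !gd !fK -!linearD br_jacobi linear0.
have h6 u : v4_d V u = 0 -> B u u = 0.
  by move=> du; rewrite /B br_alt ?linear0 // -gd du gE linear0.
exists B, (@LieAlg k V B h1 h2 h3 h4 h5 h6); split; first exact: HasBracket.
exists f; split; last by exists g.
by split=> // u v; rewrite /= /B !fK.
Qed.

(** * Structure constants on 1 + P *)

(** In the sequel a, b, c, e, f, g, h always name these fields in this order. *)
Record consts (k : fieldType) := Consts {
  xy_x : k; xy_y : k; xy_y' : k;
  yy_x : k; yy_y' : k;
  y'y_x : k; y'y_y' : k
}.

Definition consts_brackets (k : fieldType) (p : consts k) : brackets k :=
  let: Consts a b c e f g h := p in
  Brackets (0, (0, b)) (e, (0, f)) (g, (0, h)) (a, (b, c)).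

Definition row_consts (k : fieldType) (r : oneP_row k) : consts k :=
  match r with
  | Defs.row1 => Consts 0 0 0  0 0  0 0
  | row2 l  => Consts 0 1 l  0 0  0 0
  | row3 l  => Consts l 0 0  0 1  0 0
  | row4    => Consts 0 0 1  0 1  0 0
  | row5 l  => Consts 0 0 0  1 0  l 0
  | row6 l  => Consts 0 0 0  1 0  l 1
  | row7    => Consts 1 0 0  0 0  0 0
  | row8    => Consts 0 0 1  0 0  0 0
  | row9    => Consts 1 0 1  0 0  0 1
  | row10 l => Consts l 0 0  0 0  0 1
  | row11 l => Consts 1 0 l  0 0  1 0
  | row12   => Consts 0 0 1  0 0  1 0
  | row13   => Consts 0 0 0  0 0  1 0
  end.

Lemma row_consts_brackets (k : fieldType) (r : oneP_row k) :
  consts_brackets (row_consts r) = row_brackets r.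
Proof. by case: r => *; congr Brackets; coords; ring. Qed.

(** The identities for (x, y, y) and (x, y, y') give the second and the third
    equation. The identity for (y, y, y) says that [[y, y], y] + [[y', y], y'] = 0,
    and its three coordinates are the other equations. *)
Definition jacobi_consts (k : fieldType) (p : consts k) : Prop :=
  let: Consts a b c e f g h := p in
  [/\ b * e = 0, b * f = 0, b * (a + h) = 0,
      e * a + f * g = 0 & e * c + f * h + b * g = 0].

(** The constants in the basis al (x + tau y'), ga x + de y + ep y', de y'. They
    do not involve ep, since y' commutes with y' and since the two contributions
    of y' to [y, y] cancel. Writing the new x in this form rather than as
    al x + be y' confines the inverse of al to the two entries that have to be
    divided. *)
Definition rebase (k : fieldType) (al tau ga de : k) (p : consts k) : consts k :=
  let: Consts a b c e f g h := p in
  Consts (de * (a + tau * g) + ga * b) (al * b)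
    (al * (c + tau * (a + h) + tau ^+ 2 * g))
    (al^-1 * de ^+ 2 * e) (de * (f + tau * e))
    (al^-1 * de ^+ 2 * g) (de * (h + tau * g) + ga * b).

(** The polynomials that are tested are relative invariants: they are multiplied
    by nonzero factors under [rebase] as soon as the earlier tests have been
    passed. For w = e x + f y' and T y' = g x + h y', the expression e h + f g is
    their determinant, while a + h and a h + c g are the trace and the determinant
    of T. The arguments of the rows are the corresponding absolute invariants. *)
Definition row_of (k : fieldType) (p : consts k) : oneP_row k :=
  let: Consts a b c e f g h := p in
  if b != 0 then row2 (c / b)
  else if e != 0 then
    if e * h + f * g == 0 then row5 (g / e) else row6 (g / e)
  else if g != 0 then
    if a + h != 0 then row11 ((a * h + c * g) / (a + h) ^+ 2)
    else if a * h + c * g != 0 then row12 k else row13 k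
  else if f != 0 then
    if (a == 0) && (c != 0) then row4 k else row3 (a / f)
  else if (a == h) && (c != 0) then
    if h == 0 then row8 k else row9 k
  else if h != 0 then row10 (a / h)
  else if a == 0 then Defs.row1 k else row7 k.

Lemma row_ofK (k : fieldType) (r : oneP_row k) : row_of (row_consts r) = r.
Proof.
by case: r => [|l|l||l|l||||l|l||]; rewrite /= ?(eqxx, oner_eq0, mulr0, mul0r,
  mulr1, mul1r, addr0, add0r, expr1n, invr1, oner_eq0, andbF) //=.
Qed.

Definition base_map (k : fieldType) (al tau ga de ep : k) (u : onePO k) : onePO k :=
  (al * u.1 + ga * u.2.1, (de * u.2.1, al * tau * u.1 + ep * u.2.1 + de * u.2.2)).

Section Char2.
Variables (k : fieldType) (hk : 2%N \in [pchar k]).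

Lemma mulf_neq0E (u v : k) : u != 0 -> (u * v == 0) = (v == 0).
Proof. by move=> u0; rewrite mulf_eq0 (negPf u0). Qed.

Lemma mulf_eq0_r (b u : k) : b * u = 0 -> b != 0 -> u = 0.
Proof. by move=> /eqP bu bn0; move: bu; rewrite mulf_neq0E // => /eqP. Qed.

Lemma mulrC_pchar2 (u v w : k) : (u * v + v * u) * w = 0.
Proof. by rewrite [v * u]mulrC (addrr_pchar2 hk) mul0r. Qed.

(** The equations of [jacobi_consts] are used in two places only: for b nonzero,
    where they give e = f = g = 0 and a = h, and for e = g = 0 with f nonzero,
    where they give h = 0. *)
Lemma row_of_rebase (al tau ga de : k) (p : consts k) :
  al != 0 -> de != 0 -> jacobi_consts p ->
  row_of (rebase al tau ga de p) = row_of p.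
Proof.
move=> al0 de0; case: p => a b c e f g h /= [be bf bah _ hw].
rewrite mulf_neq0E //; have [b0 | bn0 /=] := eqVneq b 0; last first.
  have zero_of u : b * u = 0 -> u = 0 by move/mulf_eq0_r; apply.
  have e0 := zero_of _ be; have f0 := zero_of _ bf; have ah := zero_of _ bah.
  move: hw; rewrite e0 f0 !mul0r !add0r => /zero_of g0.
  congr row2; rewrite g0 ah !mulr0 !addr0; by field; rewrite bn0 al0.
subst b; rewrite !mulr0 !addr0 /=.
(* The common factor of the new e and g; only its product with al matters. *)
set m := al^-1 * de ^+ 2; have m0 : m != 0 by rewrite mulf_neq0 ?invr_eq0 ?expf_neq0.
have ma : al * m = de ^+ 2 by rewrite mulrA divff ?mul1r.
clearbody m.
rewrite !mulf_neq0E //; have [e0 | en0 /=] := eqVneq e 0; last first.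
  have -> : m * e * (de * (h + tau * g)) + de * (f + tau * e) * (m * g)
      = (m * de) * (e * h + f * g).
    by char2_ring hk.
  rewrite mulf_neq0E ?mulf_neq0 //.
  have -> // : m * g / (m * e) = g / e by field; rewrite en0.
subst e; rewrite !mulr0 !addr0 /=.
have [g0 | gn0 /=] := eqVneq g 0; last first.
  have -> : de * (a + tau * g) + de * (h + tau * g) = de * (a + h).
    by char2_ring hk.
  have -> : de * (a + tau * g) * (de * (h + tau * g)) +
      al * (c + tau * (a + h) + tau ^+ 2 * g) * (m * g) = de ^+ 2 * (a * h + c * g).
    by apply: (char2_eq hk) => t h2 h4 h6; ring: h2 h4 h6 ma.
  rewrite !mulf_neq0E ?expf_neq0 //.
  have [|ahn0 /=] := eqVneq (a + h) 0; first by [].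
  by congr row11; field; rewrite ahn0.
subst g; rewrite !mulr0 !addr0 /=.
have [f0 | fn0 /=] := eqVneq f 0; last first.
  move/eqP: hw; rewrite !mul0r add0r addr0 mulf_neq0E // => /eqP ->.
  rewrite addr0; have [->|an0 /=] := eqVneq a 0.
    by rewrite !mulr0 !mul0r !addr0.
  by congr row3; field; rewrite fn0.
have -> : (de * a == de * h) = (a == h).
  by rewrite (inj_eq (mulfI de0)).
have [->|anh /=] := eqVneq a h; last by case: eqVneq => //= hn0; congr row10; field; rewrite hn0.
rewrite (addrr_pchar2 hk) mulr0 addr0.
case: (c != 0) => //=; case: eqVneq => //= hn0; congr row10; by field; rewrite hn0.
Qed.

(** The map sends the new basis, in coordinates, to its expression in the old one;
    hence it carries the bracket of the new constants to that of the old ones. *)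
Lemma oneP_br_rebase (al tau ga de ep : k) (p : consts k) (u v : onePO k) :
  al != 0 -> let F := base_map al tau ga de ep in
  F (oneP_br (consts_brackets (rebase al tau ga de p)) u v)
  = oneP_br (consts_brackets p) (F u) (F v).
Proof.
move=> al0 F; rewrite /F; case: p u v => a b c e f g h [u1 [u2 u3]] [v1 [v2 v3]].
pose i := al^-1; have hi : al * i = 1 by rewrite divff.
rewrite /rebase -/i; coords; apply: (char2_eq hk) => t h2 h4 h6.
- by ring: h2 h4 h6 hi.
- by ring: h2 h4 h6 hi.
- by ring: h2 h4 h6 hi.
Qed.

End Char2.

Definition rebases_to (k : fieldType) (p q : consts k) : Prop :=
  exists al tau ga de, [/\ al != 0, de != 0 & rebase al tau ga de p = q].

(** * Normal forms *)

(** Square roots are needed in a single case: when T has trace zero and nonzero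
    determinant, the determinant is normalised to 1 by scaling T by de, which
    multiplies it by de ^ 2. *)
Lemma rebase_normal (k : closedFieldType) (hk : 2%N \in [pchar k]) (p : consts k) :
  jacobi_consts p -> rebases_to p (row_consts (row_of p)).
Proof.
have sqrt (u : k) : exists v, v ^+ 2 = u.
  have [v hv] := @solve_monicpoly k 2 (fun i => if i == 0 then u else 0) isT.
  by exists v; rewrite hv big_ord_recl big_ord1 /= expr0 mulr1 mul0r addr0.
have cancel2 (u v : k) : u + v + v = u by rewrite -addrA (addrr_pchar2 hk) addr0.
case: p => a b c e f g h /= [be bf bah hx hw].
have [b0 | bn0 /=] := eqVneq b 0; last first.
  have zero_of u : b * u = 0 -> u = 0 by move/mulf_eq0_r; apply.
  have e0 := zero_of _ be; have f0 := zero_of _ bf.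
  have /eqP := zero_of _ bah; rewrite (addr_eq0_pchar2 hk) => /eqP ah.
  move: hw; rewrite e0 f0 !mul0r !add0r => /zero_of g0.
  (* Here a = h, and adding (h / b) x to y cancels both. *)
  exists b^-1, 0, (h / b), 1; subst; split; rewrite ?oner_eq0 ?invr_eq0 //.
  rewrite /= !(mulr0, mul0r, expr0n, addr0, mul1r) divfK // (addrr_pchar2 hk).
  by rewrite mulVf // [c / b]mulrC.
subst b; move: hw; rewrite !(mul0r, addr0) => hw.
have [e0 | en0 /=] := eqVneq e 0; last first.
  (* The new x is [Y, Y] for the new y, hence T x = 0 by the Jacobi identity, and
     the choice of de makes the remaining coefficient h equal to 0 or 1. *)
  pose de := if e * h + f * g == 0 then 1 else e / (e * h + f * g).
  have de0 : de != 0 by rewrite /de; case: ifPn => ?; rewrite ?oner_eq0 ?mulf_neq0 ?invr_eq0.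
  exists (de ^+ 2 * e), (f / e), 0, de; split=> //; first by rewrite mulf_neq0 ?expf_neq0.
  have -> : rebase (de ^+ 2 * e) (f / e) 0 de (Consts a 0 c e f g h) =
      Consts 0 0 0 1 0 (g / e) (de / e * (e * h + f * g)).
    rewrite /=; congr Consts; rewrite ?(mulr0, addr0, mul0r) //.
    - rewrite (_ : a + f / e * g = (e * a + f * g) / e); first by rewrite hx mul0r mulr0.
      by field; rewrite en0.
    - rewrite (_ : _ + _ = (c * e ^+ 2 + f * e * (a + h) + f ^+ 2 * g) / e ^+ 2).
        rewrite (_ : c * e ^+ 2 + f * e * (a + h) + f ^+ 2 * g
          = e * (e * c + f * h) + f * (e * a + f * g)); last by ring.
        by rewrite hx hw !mulr0 addr0 mul0r mulr0.
      by field; rewrite en0.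
    - by field; rewrite de0 en0.
    - by rewrite divfK // (addrr_pchar2 hk) mulr0.
    - by field; rewrite en0 de0.
    - by field; rewrite en0.
  case: ifPn => [/eqP -> | kn0] /=; first by rewrite mulr0.
  by rewrite /de (negPf kn0); congr Consts; field; rewrite en0 kn0.
subst e; move: hx hw; rewrite !(mul0r, add0r) /= => fg fh.
have [g0 | gn0 /=] := eqVneq g 0; last first.
  have f0 : f = 0 by move/eqP: fg; rewrite mulrC mulf_neq0E // => /eqP.
  (* The new x is [Y', Y] for the new y: the matrix of T becomes a companion
     matrix, which exhibits the trace and the determinant. *)
  have key de : de != 0 ->
      rebase (de ^+ 2 * g) (h / g) 0 de (Consts a 0 c 0 f g h) =
      Consts (de * (a + h)) 0 (de ^+ 2 * (a * h + c * g)) 0 0 1 0.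
    move=> de0; rewrite /= f0 !(mulr0, addr0, mul0r); congr Consts.
    - by field; rewrite gn0.
    - transitivity (de ^+ 2 * (a * h + c * g + h ^+ 2 + h ^+ 2)); last by rewrite cancel2.
      by field; rewrite gn0.
    - by field; rewrite gn0 de0.
    - by rewrite divfK // (addrr_pchar2 hk) mulr0.
  have use de r : de != 0 -> Consts (de * (a + h)) 0 (de ^+ 2 * (a * h + c * g)) 0 0 1 0 = r ->
      rebases_to (Consts a 0 c 0 f g h) r.
    move=> de0 <-; exists (de ^+ 2 * g), (h / g), 0, de; split=> //.
      by rewrite mulf_neq0 ?expf_neq0.
    exact: key.
  have [ah | ahn0 /=] := eqVneq (a + h) 0; last first.
    apply: (use (a + h)^-1); rewrite ?invr_eq0 //=.
    by rewrite mulVf // exprVn [(a + h) ^- 2 * _]mulrC.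
  rewrite ah in use *; have [D0 | Dn0 /=] := eqVneq (a * h + c * g) 0.
    by apply: (use 1); rewrite ?oner_eq0 // D0 !mulr0.
  have [de hde] := sqrt (a * h + c * g)^-1.
  apply: (use de); last by rewrite mulr0 hde mulVf.
  by move: (invr_neq0 Dn0); rewrite -hde expf_eq0.
subst g; clear fg bah.
have key al tau de : rebase al tau 0 de (Consts a 0 c 0 f 0 h) =
    Consts (de * a) 0 (al * (c + tau * (a + h))) 0 (de * f) 0 (de * h).
  by rewrite /= !(mulr0, addr0, mul0r).
have use al tau de r : al != 0 -> de != 0 ->
    Consts (de * a) 0 (al * (c + tau * (a + h))) 0 (de * f) 0 (de * h) = r ->
    rebases_to (Consts a 0 c 0 f 0 h) r.
  by move=> al0 de0 <-; exists al, tau, 0, de; split=> //; apply: key.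
clear key; have [f0 | fn0 /=] := eqVneq f 0; last first.
  have h0 : h = 0 by exact: (mulf_eq0_r fh).
  have [a0 | an0 /=] := eqVneq a 0; last first.
    apply: (use 1 (c / a) f^-1); rewrite ?oner_eq0 ?invr_eq0 //.
    by rewrite h0 addr0 divfK // (addrr_pchar2 hk) !mulr0 mulVf // mulrC.
  rewrite a0 h0 in use *; have [c0 | cn0 /=] := eqVneq c 0.
    apply: (use 1 0 f^-1); rewrite ?oner_eq0 ?invr_eq0 //=.
    by rewrite c0 !(mulr0, addr0, mul0r) mulVf.
  apply: (use c^-1 0 f^-1); rewrite ?invr_eq0 //=.
  by rewrite !(mulr0, addr0, mul0r) !mulVf.
subst f; clear fh.
have [ah | anh /=] := eqVneq a h.
  have E al de : Consts (de * a) 0 (al * (c + 0 * (a + h))) 0 (de * 0) 0 (de * h)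
      = Consts (de * h) 0 (al * c) 0 0 0 (de * h).
    by rewrite ah !(mulr0, addr0, mul0r).
  have [c0 | cn0 /=] := eqVneq c 0; have [h0 | hn0 /=] := eqVneq h 0.
  - by apply: (use 1 0 1); rewrite ?oner_eq0 // E ah c0 h0 eqxx !mulr0.
  - apply: (use 1 0 h^-1); rewrite ?oner_eq0 ?invr_eq0 // E c0 mulr0 ah.
    by rewrite mulVf // divff.
  - apply: (use c^-1 0 1); rewrite ?oner_eq0 ?invr_eq0 // E h0 mulr0.
    by rewrite mulVf.
  - by apply: (use c^-1 0 h^-1); rewrite ?oner_eq0 ?invr_eq0 // E !mulVf.
(* The eigenvalues a and h of T differ, and tau makes the new x an eigenvector. *)
have ahn0 : a + h != 0 by rewrite (addr_eq0_pchar2 hk).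
have E de : Consts (de * a) 0 (1 * (c + c / (a + h) * (a + h))) 0 (de * 0) 0 (de * h)
    = Consts (de * a) 0 0 0 0 0 (de * h).
  by rewrite divfK // (addrr_pchar2 hk) !mulr0.
have [h0 | hn0 /=] := eqVneq h 0; last first.
  apply: (use 1 (c / (a + h)) h^-1); rewrite ?oner_eq0 ?invr_eq0 // E.
  by rewrite mulVf // mulrC.
have an0 : a != 0 by rewrite -h0.
apply: (use 1 (c / (a + h)) a^-1); rewrite ?oner_eq0 ?invr_eq0 // E.
by rewrite (negPf an0) h0 mulr0 mulVf.
Qed.

(** * The classification on 1 + P *)

Section Bilinear.
Variables (k : fieldType) (L : lieAlg k).
Implicit Types u v w : L.

Lemma br0l w : br 0 w = 0.
Proof. exact: (linear0 (lin (br_linl w))). Qed.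
Lemma br0r w : br w 0 = 0.
Proof. exact: (linear0 (lin (br_linr w))). Qed.
Lemma brDl u v w : br (u + v) w = br u w + br v w.
Proof. exact: (linearD (lin (br_linl w))). Qed.
Lemma brDr u v w : br w (u + v) = br w u + br w v.
Proof. exact: (linearD (lin (br_linr w))). Qed.
Lemma brZl a u w : br (a *: u) w = a *: br u w.
Proof. exact: (linearZZ (lin (br_linl w))). Qed.
Lemma brZr a u w : br w (a *: u) = a *: br w u.
Proof. exact: (linearZZ (lin (br_linr w))). Qed.

Lemma addvv_pchar2 (hk : 2%N \in [pchar k]) (V : lmodType k) (v : V) : v + v = 0.
Proof. by rewrite -mulr2n -scaler_nat (pcharf0 hk) scale0r. Qed.

(** The braiding contributes [v', u'], which vanishes for all pairs of basis
    vectors of the objects considered here. *)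
Lemma br_sym (hk : 2%N \in [pchar k]) u v :
  br (v4_d L v) (v4_d L u) = 0 -> br u v = br v u.
Proof.
move=> h; have /eqP := br_anti u v; rewrite h addr0 addr_eq0 => /eqP ->.
by rewrite -scaleN1r (oppr_pchar2 hk) scale1r.
Qed.

End Bilinear.

Section Char2.
Variables (k : fieldType) (hk : 2%N \in [pchar k]).

Lemma onePO_expand (u : onePO k) :
  u = u.1 *: e_x k + u.2.1 *: e_y k + u.2.2 *: e_y' k.
Proof. by coords; ring. Qed.

(** Applying d to the brackets of basis vectors fixes the shape of the constants:
    [x, y'] is d [x, y], while [y, y] and [y', y] lie in the kernel of d. *)
Lemma onePO_bracket (C : onePO k -> onePO k -> onePO k) (L : lieAlg k) :
  has_bracket C L -> exists2 p, jacobi_consts p &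
    has_bracket (V := onePO k) (oneP_br (consts_brackets p)) L.
Proof.
case=> B h1 h2 h3 h4 h5 h6 _; set L0 := LieAlg _ _ _ _ _ _.
pose x : L0 := e_x k; pose y : L0 := e_y k; pose y' : L0 := e_y' k.
have dx : v4_d L0 x = 0 by [].
have dy : v4_d L0 y = y' by [].
have dy' : v4_d L0 y' = 0 by [].
have xx : br x x = 0 by apply: br_alt.
have y'y' : br y' y' = 0 by apply: br_alt.
have yx : br y x = br x y by apply: (br_sym hk); rewrite dx br0l.
have y'x : br y' x = br x y' by apply: (br_sym hk); rewrite dx br0l.
have yy' : br y y' = br y' y by apply: (br_sym hk); rewrite dy' br0l.
have dbl (u : L0) : u + u = 0 by exact: (addvv_pchar2 hk).
have d1 : v4_d L0 (br x y) = br x y' by rewrite br_d dx br0l add0r dy.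
have d2 : v4_d L0 (br y y) = 0.
  by rewrite br_d dy yy'; exact: dbl.
have d3 : v4_d L0 (br y' y) = 0 by rewrite br_d dy dy' br0l add0r.
have j1 := br_jacobi x y y; have j2 := br_jacobi x y y'; have j3 := br_jacobi y y y.
rewrite dx dy dy' ?yx ?(br0l, br0r) ?dbl ?add0r -?addrA ?dbl ?addr0 in j1 j2 j3.
have E : forall u v : L0, br u v = oneP_br (Brackets (br x y') (br y y) (br y' y) (br x y)) u v.
  move=> u v; rewrite [u in LHS]onePO_expand [v in LHS]onePO_expand -/x -/y -/y'.
  rewrite !(brDl, brDr, brZl, brZr) xx y'y' yx y'x yy' /oneP_br /=.
  by case: (br x y) (br x y') (br y y) (br y' y) => [? [? ?]] [? [? ?]] [? [? ?]] [? [? ?]];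
    coords; ring.
have Exy : br x y = ((br x y).1, ((br x y).2.1, (br x y).2.2)) by case: (br x y) => ? [].
have Exy' : br x y' = (0, (0, (br x y).2.1)) by rewrite -d1.
have [e [f Eyy]] : exists e f : k, br y y = (e, (0, f)).
  case: (br y y) d2 => e [? f] /= [->]; by exists e, f.
have [g [h Ey'y]] : exists g h : k, br y' y = (g, (0, h)).
  case: (br y' y) d3 => e' [? f'] /= [->]; by exists e', f'.
move: (br x y).1 (br x y).2.1 (br x y).2.2 Exy Exy' => a b c Exy Exy'.
have EB : forall u v : L0, br u v = oneP_br (consts_brackets (Consts (k := k) a b c e f g h)) u v.
  by move=> u v; rewrite E Exy Exy' Eyy Ey'y.
exists (Consts (k := k) a b c e f g h); last by apply: HasBracket; exact: EB.
rewrite !EB in j1 j2 j3.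
have c1 := congr1 (fun w : onePO k => w.2.2) j1.
have c2 := congr1 (fun w : onePO k => w.2.2) j2.
have c3 := congr1 (fun w : onePO k => w.1) j3.
have c4 := congr1 (fun w : onePO k => w.2.1) j3.
have c5 := congr1 (fun w : onePO k => w.2.2) j3.
rewrite /= /GRing.scale /= in c1 c2 c3 c4 c5.
split.
- by apply: etrans c4; char2_ring hk.
- by apply: etrans c1; char2_ring hk.
- by apply: etrans c2; char2_ring hk.
- by apply: etrans c3; char2_ring hk.
- by apply: etrans c5; char2_ring hk.
Qed.

Lemma base_map_linear (al tau ga de ep : k) : linear (base_map al tau ga de ep).
Proof. by move=> t [? [? ?]] [? [? ?]]; coords; ring. Qed.

Lemma base_map_bij (al tau ga de ep : k) :
  al != 0 -> de != 0 -> bijective (base_map al tau ga de ep).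
Proof.
move=> al0 de0.
exists (fun u : onePO k => ((u.1 - ga * (u.2.1 / de)) / al, (u.2.1 / de,
   (u.2.2 - tau * (u.1 - ga * (u.2.1 / de)) - ep * (u.2.1 / de)) / de))).
  by move=> [? [? ?]]; coords; field; rewrite ?al0 ?de0.
by move=> [? [? ?]]; coords; field; rewrite ?al0 ?de0.
Qed.

Lemma base_map_morph (al tau ga de ep : k) (u : onePO k) :
  base_map al tau ga de ep (v4_d (onePO k) u) = v4_d (onePO k) (base_map al tau ga de ep u).
Proof. by case: u => [? [? ?]]; coords; ring. Qed.

(** The kernel of d is spanned by x and y', and d f(y) = f(y'), so that f is
    triangular. If al were 0, f would not be injective on that kernel. *)
Lemma onePO_morph (f : {linear onePO k -> onePO k}) :
  v4_morph f -> injective f -> exists al tau ga de ep : k,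
  [/\ al != 0, de != 0 & forall u, f u = base_map al tau ga de ep u].
Proof.
move=> fd finj; have fy' : f (e_y' k) = v4_d (onePO k) (f (e_y k)) by rewrite -fd.
have fx : v4_d (onePO k) (f (e_x k)) = 0 by rewrite -fd (linear0 f).
case Ex: (f (e_x k)) fx => [al [al' be]] /= [al'0]; rewrite {}al'0 in Ex.
case Ey: (f (e_y k)) fy' => [ga [de ep]] fy'.
have E u : f u =
    (al * u.1 + ga * u.2.1, (de * u.2.1, be * u.1 + ep * u.2.1 + de * u.2.2)).
  by rewrite {1}[u]onePO_expand !linearD !linearZZ Ex Ey fy'; coords; ring.
have inj0 u : f u = 0 -> u = 0 by move=> fu; apply: finj; rewrite fu linear0.
have de0 : de != 0.
  apply/eqP => de0; have /inj0 [] : f (e_y' k) = 0 by rewrite E de0; coords; ring.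
  by move/eqP; rewrite oner_eq0.
have al0 : al != 0.
  apply/eqP => al0; have /inj0 [] : f (de *: e_x k + be *: e_y' k) = 0.
    by rewrite E al0; coords; char2_ring hk.
  by rewrite scaler0 addr0 /GRing.scale /= mulr1 => de0E; rewrite de0E eqxx in de0.
by exists al, (be / al), ga, de, ep; split=> // u; rewrite E /base_map [al * (be / al)]mulrC divfK.
Qed.

Lemma consts_brackets_inj (p q : consts k) :
  (forall u v, oneP_br (consts_brackets p) u v = oneP_br (consts_brackets q) u v) -> p = q.
Proof.
case: p q => [a b c e f g h] [a' b' c' e' f' g' h'] E.
have := E (e_y' k) (e_y k); have := E (e_y k) (e_y k); have := E (e_x k) (e_y k).
rewrite /oneP_br /=.
rewrite /= !(mulr0, mul0r, mulr1, scale0r, scale1r, addr0, add0r).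
by move=> [-> -> ->] [-> ->] [-> ->].
Qed.

(** Both q and the constants rebased along f describe the bracket of p pulled back
    along f, and a bracket has only one septuple of constants. *)
Lemma morph_rebase (p q : consts k) (f : {linear onePO k -> onePO k}) :
  v4_morph f -> injective f ->
  (forall u v, f (oneP_br (consts_brackets q) u v)
               = oneP_br (consts_brackets p) (f u) (f v)) ->
  rebases_to p q.
Proof.
move=> fd finj fb; have [al [tau [ga [de [ep [al0 de0 E]]]]]] := onePO_morph fd finj.
exists al, tau, ga, de; split=> //; apply: consts_brackets_inj => u v.
by apply: finj; rewrite fb !E oneP_br_rebase.
Qed.

Lemma lie_iso_rebase (L M : lieAlg k) (p q : consts k) :
  has_bracket (V := onePO k) (oneP_br (consts_brackets p)) L ->
  has_bracket (V := onePO k) (oneP_br (consts_brackets q)) M ->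
  lie_iso M L <-> rebases_to p q.
Proof.
case=> B ? ? ? ? ? ? EB [C ? ? ? ? ? ? EC].
split=> [[f [[fd fb] /bij_inj finj]] | [al [tau [ga [de [al0 de0 E]]]]]].
  by apply: (morph_rebase fd finj) => u v; rewrite -EB -EC; apply: fb.
exists (lin (base_map_linear al tau ga de 0)); split; last exact: base_map_bij.
split=> [v|u v]; first exact: base_map_morph.
by rewrite /= EB EC -E (oneP_br_rebase hk).
Qed.

Lemma row_bracket (r : oneP_row k) :
  has_bracket (V := onePO k) (oneP_br (consts_brackets (row_consts r))) (rowA hk r).
Proof. by apply: HasBracket => u v; rewrite row_consts_brackets. Qed.

End Char2.

Theorem classification (k : closedFieldType) (hk : 2%N \in [pchar k]) (L : lieAlg k) :
  v4_iso L (onePO k) -> exists! r : oneP_row k, lie_iso L (rowA hk r).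
Proof.
move=> /transport[C [M [/(onePO_bracket hk)[p jp Mp] LM]]].
have isoE (r : oneP_row k) : lie_iso L (rowA hk r) <-> rebases_to p (row_consts r).
  rewrite -(lie_iso_rebase hk Mp (row_bracket hk r)).
  split=> h; first exact: lie_iso_trans (lie_iso_sym h) LM.
  exact: lie_iso_trans LM (lie_iso_sym h).
exists (row_of p); split=> [|r /isoE [al [tau [ga [de [al0 de0 E]]]]]].
  by apply/isoE/rebase_normal.
by rewrite -[r]row_ofK -E row_of_rebase.
Qed.

(** * Lie algebras on P and 2.1 *)

Local Notation twoO k := (sumO (oneO k) (oneO k)).

Definition two_br (k : fieldType) (w u v : k^o * k^o) : k^o * k^o :=
  (u.1 * v.2 + u.2 * v.1) *: w.

Section Char2.
Variables (k : fieldType) (hk : 2%N \in [pchar k]).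

(** With [y, y] = u y' and [y', y] = v y', the identity for (y, y, y) reads
    u v = 0. *)
Lemma P_bracket (C : PO k -> PO k -> PO k) (A : lieAlg k) : has_bracket C A ->
  exists u v : k, u * v = 0 /\ has_bracket (V := PO k) (P_br (0, u) (0, v)) A.
Proof.
case=> B h1 h2 h3 h4 h5 h6 _; set L0 := LieAlg _ _ _ _ _ _.
pose y : L0 := (1, 0) : PO k; pose y' : L0 := (0, 1) : PO k.
have dy : v4_d L0 y = y' by [].
have dy' : v4_d L0 y' = 0 by [].
have y'y' : br y' y' = 0 by apply: br_alt.
have yy' : br y y' = br y' y by apply: (br_sym hk); rewrite dy' br0l.
have dbl (u : L0) : u + u = 0 by exact: (addvv_pchar2 hk).
have d2 : v4_d L0 (br y y) = 0 by rewrite br_d dy yy'; exact: dbl.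
have d3 : v4_d L0 (br y' y) = 0 by rewrite br_d dy dy' br0l add0r.
have j := br_jacobi y y y.
rewrite dy !dbl !add0r -addrA dbl addr0 in j.
have E : forall u v : L0, br u v = P_br (br y y) (br y' y) u v.
  have P_expand (u : PO k) : u = u.1 *: y + u.2 *: y' by coords; ring.
  move=> u v; rewrite [u in LHS]P_expand [v in LHS]P_expand.
  rewrite !(brDl, brDr, brZl, brZr) y'y' yy' /P_br /=.
  by case: (br y y) (br y' y) => [? ?] [? ?]; coords; ring.
have [e Eyy] : exists e : k, br y y = (0, e).
  by case: (br y y) d2 => ? e /= [->]; exists e.
have [g Ey'y] : exists g : k, br y' y = (0, g).
  by case: (br y' y) d3 => ? g /= [->]; exists g.
have EB : forall u v : L0, br u v = P_br (0, e) (0, g) u v.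
  by move=> u v; rewrite E Eyy Ey'y.
exists e, g; split; last by apply: HasBracket; exact: EB.
rewrite !EB in j; have c := congr1 (fun w : PO k => w.2) j.
rewrite /= /GRing.scale /= in c.
by apply: etrans c; char2_ring hk.
Qed.

Lemma two_bracket (C : twoO k -> twoO k -> twoO k) (A : lieAlg k) : has_bracket C A ->
  exists w, has_bracket (V := twoO k) (two_br w) A.
Proof.
case=> B h1 h2 h3 h4 h5 h6 _; set L0 := LieAlg _ _ _ _ _ _.
pose y : L0 := (1, 0) : twoO k; pose z : L0 := (0, 1) : twoO k.
have d0 (u : L0) : v4_d L0 u = 0 by [].
have yy : br y y = 0 by apply: br_alt.
have zz : br z z = 0 by apply: br_alt.
have zy : br z y = br y z by apply: (br_sym hk); rewrite d0 br0l.
have expand (u : twoO k) : u = u.1 *: y + u.2 *: z by coords; ring.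
suff EB : forall u v : L0, br u v = two_br (br y z) u v.
  by exists (br y z); apply: HasBracket; exact: EB.
move=> u v.
rewrite [u in LHS]expand [v in LHS]expand.
rewrite !(brDl, brDr, brZl, brZr) yy zz zy /two_br /=.
by case: (br y z) => [? ?]; coords; ring.
Qed.

Lemma scale_bij (V : lmodType k) (de : k) : de != 0 -> bijective ( *:%R de : V -> V).
Proof. by move=> de0; exists ( *:%R de^-1); [exact: scalerK|exact: scalerKV]. Qed.

Lemma lie_iso_scale (V : ver4 k) C D (A B : lieAlg k) (de : k) : de != 0 ->
  has_bracket (V := V) C A -> has_bracket (V := V) D B ->
  (forall u v, C (de *: u) (de *: v) = de *: D u v) -> lie_iso B A.
Proof.
move=> de0 [C' ? ? ? ? ? ? EC] [D' ? ? ? ? ? ? ED] E.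
exists ( *:%R de : {linear V -> V}); split; last exact: scale_bij.
by split=> [v|u v]; rewrite /= ?linearZZ // EC ED E.
Qed.

(** The coefficients of u' in [u, u] and [u', u], for the listed algebras on P. *)
Definition P_consts (s : small) : k * k :=
  match s with sPs => (0, 1) | sPn => (1, 0) | _ => (0, 0) end.

Lemma smallA_P s : s \in [:: sPa; sPs; sPn] ->
  has_bracket (V := PO k) (P_br (0, (P_consts s).1) (0, (P_consts s).2)) (smallA hk s).
Proof.
case: s => // _; apply: HasBracket => u v //.
by rewrite /zero_br; coords; ring.
Qed.

(** The listed algebras on 2.1 have a bracket with values in the first axis, and
    this is the coefficient. *)
Definition two_const (s : small) : k := if s == sL2 then 1 else 0.

Lemma smallA_two s : s \in [:: sOne2; sL2] ->
  has_bracket (V := twoO k) (two_br (two_const s, 0)) (smallA hk s).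
Proof.
case: s => // _; apply: HasBracket => u v //.
by rewrite /zero_br /two_const; coords; ring.
Qed.

(** A rescaling of y by de multiplies the two constants by de, and at most one of
    them is nonzero. *)
Lemma classify_P (A : lieAlg k) : v4_iso A (PO k) ->
  exists2 s, s \in [:: sPa; sPs; sPn] & lie_iso A (smallA hk s).
Proof.
move=> /transport[C [M [/P_bracket[u [v [uv0 Mb]]] AM]]].
suff [s sP sM] : exists2 s, s \in [:: sPa; sPs; sPn] & lie_iso (smallA hk s) M.
  by exists s => //; exact: lie_iso_trans AM (lie_iso_sym sM).
have [u0 | un0] := eqVneq u 0; last first.
  have v0 : v = 0 by exact: (mulf_eq0_r uv0).
  exists sPn => //; apply: (lie_iso_scale (de := u^-1) _ Mb (@smallA_P sPn isT)).
    by rewrite invr_eq0.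
  by move=> [? ?] [? ?]; rewrite v0; coords; field.
have [v0 | vn0] := eqVneq v 0; last first.
  exists sPs => //; apply: (lie_iso_scale (de := v^-1) _ Mb (@smallA_P sPs isT)).
    by rewrite invr_eq0.
  by move=> [? ?] [? ?]; rewrite u0; coords; field.
exists sPa => //; apply: (lie_iso_scale (de := 1) _ Mb (@smallA_P sPa isT)).
  by rewrite oner_eq0.
by move=> [? ?] [? ?]; rewrite u0 v0; coords; ring.
Qed.

Definition two_map (W : lmodType k) (U V : W) (p : k^o * k^o) : W := p.1 *: U + p.2 *: V.

Lemma two_map_linear (W : lmodType k) (U V : W) : linear (two_map U V).
Proof.
by move=> a p q; rewrite /two_map /= !scalerDl scalerDr !scalerA addrACA.
Qed.

Lemma two_mapE (W : lmodType k) (f : {linear (k^o * k^o)%type -> W}) z :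
  f z = two_map (f (1, 0)) (f (0, 1)) z.
Proof. by rewrite /two_map -!linearZZ -linearD; congr (f _); coords; ring. Qed.

(** If the bracket of the two axes is w and (w, z) has determinant 1, then
    [w, z] = w. *)
Lemma lie_iso_two w (z : k^o * k^o) (A B : lieAlg k) :
  w.1 * z.2 + w.2 * z.1 = 1 ->
  has_bracket (V := twoO k) (two_br w) A -> has_bracket (V := twoO k) (two_br (1, 0)) B ->
  lie_iso B A.
Proof.
move=> wz [C ? ? ? ? ? ? EC] [D ? ? ? ? ? ? ED].
case: w z wz EC => [w1 w2] [z1 z2] /= wz EC.
exists (lin (two_map_linear ((w1, w2) : twoO k) (z1, z2))); split; first split.
- by move=> v; coords; ring.
- move=> u v; rewrite /= EC ED; case: u v => u1 u2 [v1 v2].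
  coords; apply/eqP; rewrite -(addr_eq0_pchar2 hk); apply/eqP; apply: (char2_eq hk) => t h2 h4 h6.
  + have h : w1 * z2 = 1 + w2 * z1 by rewrite -wz -addrA (addrr_pchar2 hk) addr0.
    ring: h2 h4 h6 h.
  + have h : w1 * z2 = 1 + w2 * z1 by rewrite -wz -addrA (addrr_pchar2 hk) addr0.
    ring: h2 h4 h6 h.
exists (two_map ((z2, w2) : twoO k) (z1, w1)) => [[u1 u2]|[u1 u2]]; coords.
- by rewrite -[RHS]mulr1 -wz; char2_ring hk.
- by rewrite -[RHS]mulr1 -wz; char2_ring hk.
- by rewrite -[RHS]mulr1 -wz; char2_ring hk.
- by rewrite -[RHS]mulr1 -wz; char2_ring hk.
Qed.

Lemma classify_two (A : lieAlg k) : v4_iso A (twoO k) ->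
  exists2 s, s \in [:: sOne2; sL2] & lie_iso A (smallA hk s).
Proof.
move=> /transport[C [M [/two_bracket[[w1 w2] Mb] AM]]].
suff [s sP sM] : exists2 s, s \in [:: sOne2; sL2] & lie_iso (smallA hk s) M.
  by exists s => //; exact: lie_iso_trans AM (lie_iso_sym sM).
have [w10 | w1n0] := eqVneq w1 0; last first.
  exists sL2 => //; apply: (lie_iso_two (z := (0, w1^-1)) _ Mb (@smallA_two sL2 isT)).
  by rewrite /= mulr0 addr0 divff.
have [w20 | w2n0] := eqVneq w2 0; last first.
  exists sL2 => //; apply: (lie_iso_two (z := (w2^-1, 0)) _ Mb (@smallA_two sL2 isT)).
  by rewrite /= mulr0 add0r divff.
exists sOne2 => //; apply: (lie_iso_scale (de := 1) _ Mb (@smallA_two sOne2 isT)).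
  by rewrite oner_eq0.
by move=> [? ?] [? ?]; rewrite w10 w20 /two_const; coords; ring.
Qed.

End Char2.

(** * Subalgebras *)

Section Char2.
Variables (k : fieldType) (hk : 2%N \in [pchar k]).

Lemma oneP_brE (a b c e f g h : k) (u v : onePO k) :
  oneP_br (consts_brackets (Consts a b c e f g h)) u v =
  ((u.1 * v.2.1 + u.2.1 * v.1) * a + u.2.1 * v.2.1 * e + (u.2.2 * v.2.1 + u.2.1 * v.2.2) * g,
   ((u.1 * v.2.1 + u.2.1 * v.1) * b,
    (u.1 * v.2.2 + u.2.2 * v.1) * b + (u.1 * v.2.1 + u.2.1 * v.1) * c
    + u.2.1 * v.2.1 * f + (u.2.2 * v.2.1 + u.2.1 * v.2.2) * h)).
Proof. by coords; ring. Qed.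

Lemma P_brE (p q : k) (u v : PO k) :
  P_br (0, p) (0, q) u v = (0, u.1 * v.1 * p + (u.2 * v.1 + u.1 * v.2) * q).
Proof. by coords; ring. Qed.

Lemma two_brE (t : k) (u v : twoO k) :
  two_br (t, 0) u v = ((u.1 * v.2 + u.2 * v.1) * t, 0).
Proof. by coords; ring. Qed.

(** For Y = ga x + de y + ep y' one has [Y, Y] = de ^ 2 w and
    [Y', Y] = de ^ 2 T y' + de ga b y'. These are multiples of Y' = de y' if and
    only if e = g = 0, and then the coefficients are de f and de h + ga b. The
    factor de is absorbed because at most one of u, v is nonzero; for b nonzero,
    ga makes the second coefficient arbitrary. *)
Definition sub_P_test (p : consts k) (u v : k) : bool :=
  let: Consts a b c e f g h := p in
  [&& e == 0, g == 0, (f == 0) == (u == 0) & (b != 0) || ((h == 0) == (v == 0))].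

Lemma is_subalg_P (p : consts k) (u v : k) (L A : lieAlg k) :
  jacobi_consts p -> u * v = 0 ->
  has_bracket (V := onePO k) (oneP_br (consts_brackets p)) L ->
  has_bracket (V := PO k) (P_br (0, u) (0, v)) A ->
  is_subalg L A <-> sub_P_test p u v.
Proof.
move=> jp uv0 [B ? ? ? ? ? ? EB] [C ? ? ? ? ? ? EC].
case: p jp EB => a b c e f g h [be bf bah hx hw] EB; split.
  move=> [F [[Fd Fb] Finj]]; rewrite /= in F Fd Fb Finj *.
  have F01 : F (0, 1) = v4_d (onePO k) (F (1, 0)) by rewrite -Fd.
  case F10: (F (1, 0)) F01 => [ga [de ep]] F01.
  have de0 : de != 0.
    apply/eqP => de0; suff [] : (0, 1) = 0 :> PO k by move/eqP; rewrite oner_eq0.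
    by apply: Finj; rewrite F01 de0 linear0.
  have FE z : F z = (ga * z.1, (de * z.1, ep * z.1 + de * z.2)).
    by rewrite two_mapE F10 F01; coords; ring.
  have := Fb (1, 0) (1, 0); have := Fb (0, 1) (1, 0).
  rewrite !FE EB EB EC EC !oneP_brE !P_brE /=.
  rewrite !(mulr0, mul0r, addr0, add0r, mulr1, mul1r, mulrC_pchar2 hk).
  case=> /esym/eqP; rewrite !mulf_eq0 (negPf de0) /= => /eqP g0 vE.
  case=> /esym/eqP; rewrite !mulf_eq0 (negPf de0) /= => e0 uE.
  have {}uE : u = de * f by apply: (mulfI de0); rewrite uE mulrA.
  rewrite /sub_P_test e0 g0 eqxx uE mulf_neq0E // eqxx /=.
  case: eqVneq => //= b0; rewrite b0 mulr0 add0r -mulrA in vE.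
  by rewrite (mulfI de0 vE) mulf_neq0E // eqxx.
move=> /and4P [/eqP e0 /eqP g0 /eqP fu bhv]; subst e g.
suff [ga [de [de0 uE vE]]] : exists ga de, [/\ de != 0, u = de * f & v = de * h + ga * b].
  exists (lin (two_map_linear ((ga, (de, 0)) : onePO k) (0, (0, de)))); split; last first.
    move=> [x1 x2] [y1 y2]; rewrite /= /two_map /= => -[_].
    rewrite !scaler0 !addr0 !add0r ![_ *: _]mulrC.
    by move=> /(mulfI de0) -> /(mulfI de0) ->.
  split=> [z|w z]; first by case: z => ? ?; coords; ring.
  rewrite /= EB EC oneP_brE P_brE uE vE.
  by coords; char2_ring hk.
have [b0 | bn0] := eqVneq b 0; last first.
  have f0 : f = 0 by exact: (mulf_eq0_r bf).
  exists ((v - h) / b), 1; split; first exact: oner_neq0.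
    by apply/eqP; rewrite f0 mulr0 -fu f0.
  by rewrite divfK // mul1r addrC subrK.
move: bhv; rewrite b0 eqxx /= => /eqP hv.
have [u0 | un0] := eqVneq u 0; last first.
  have fn0 : f != 0 by rewrite -(negbK (f == 0)) fu un0.
  have h0 : h = 0.
    by move/eqP: hw; rewrite mul0r b0 mul0r addr0 add0r mulf_neq0E // => /eqP.
  have v0 : v = 0 by exact: (mulf_eq0_r uv0).
  exists 0, (u / f); split; first by rewrite mulf_neq0 ?invr_eq0.
    by rewrite divfK.
  by rewrite h0 v0 !mulr0 addr0.
have /eqP f0 : f == 0 by rewrite fu u0.
have [v0 | vn0] := eqVneq v 0; last first.
  have hn0 : h != 0 by rewrite hv.
  exists 0, (v / h); split; first by rewrite mulf_neq0 ?invr_eq0.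
    by rewrite u0 f0 mulr0.
  by rewrite divfK // mulr0 addr0.
have /eqP h0 : h == 0 by rewrite hv v0.
by exists 0, 1; rewrite oner_eq0 u0 f0 v0 h0 !mulr0 addr0.
Qed.

(** The image of an injection of 2.1 is the kernel of d, spanned by x and y', with
    [x, y'] = b y'. *)
Lemma is_subalg_two (p : consts k) (t : k) (L A : lieAlg k) :
  has_bracket (V := onePO k) (oneP_br (consts_brackets p)) L ->
  has_bracket (V := twoO k) (two_br (t, 0)) A ->
  is_subalg L A <-> (xy_y p == 0) == (t == 0).
Proof.
move=> [B ? ? ? ? ? ? EB] [C ? ? ? ? ? ? EC].
case: p EB => a b c e f g h EB /=; split.
  move=> [F [[Fd Fb] Finj]]; rewrite /= in F Fd Fb Finj *.
  have kerF z : (F z).2.1 = 0.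
    have := Fd z; rewrite /= linear0; by case.
  have := kerF (1, 0); have := kerF (0, 1).
  case FV: (F (0, 1)) => [V1 [V2 V3]]; case FU: (F (1, 0)) => [U1 [U2 U3]] /=.
  move=> V20 U20; subst U2 V2.
  have FE z : F z = (U1 * z.1 + V1 * z.2, (0, U3 * z.1 + V3 * z.2)).
    by rewrite two_mapE FU FV; coords; ring.
  have F0 z : F z = 0 -> z = 0 by move=> Fz; apply: Finj; rewrite Fz linear0.
  set D := U1 * V3 + U3 * V1.
  have D0 : D != 0.
    apply/eqP => D0.
    have [V30 U30] : (V3, U3) = 0.
      by apply: F0; rewrite FE /=; coords; [rewrite -[RHS]D0 /D; ring|by []|rewrite /D; char2_ring hk].
    have [V10 U10] : (V1, U1) = 0.
      by apply: F0; rewrite FE /=; coords; [char2_ring hk|by []|rewrite -[RHS]D0 /D; ring].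
    have [] : (1, 0) = 0 :> k * k by apply: F0; rewrite FE V30 U30 V10 U10; coords; ring.
    by move/eqP; rewrite oner_eq0.
  have := Fb (1, 0) (0, 1).
  rewrite !FE EB EC oneP_brE /two_br /=.
  rewrite !(mulr0, mul0r, addr0, add0r, mulr1, mul1r, scale1r) => -[].
  rewrite -/D => /esym U1t U3t.
  apply/eqP; have [t0 | tn0] := eqVneq t 0.
    by apply/eqP/(mulfI D0); rewrite -U3t t0 !mulr0.
  apply/eqP => b0; move/eqP: U1t; rewrite eq_sym mulf_eq0 (negPf tn0) orbF => /eqP U10.
  move/eqP: U3t; rewrite b0 mulr0 mulf_eq0 (negPf tn0) orbF => /eqP U30.
  by move: D0; rewrite /D U10 U30 !mul0r addr0 eqxx.
move=> /eqP bt.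
suff [U1 [U3 [V1 [V3 [D0 bE]]]]] : exists U1 U3 V1 V3 : k,
    U1 * V3 + U3 * V1 != 0 /\ (t * U1, t * U3) = (0, (U1 * V3 + U3 * V1) * b).
  set D := U1 * V3 + U3 * V1 in D0 bE.
  exists (lin (two_map_linear ((U1, (0, U3)) : onePO k) (V1, (0, V3)))); split; last first.
    apply: (can_inj (g := fun z : onePO k =>
      ((V3 * z.1 + V1 * z.2.2) / D, (U3 * z.1 + U1 * z.2.2) / D))).
    move=> [x1 x2]; coords; apply: (mulIf D0); rewrite divfK // /D; char2_ring hk.
  split=> [z|w z]; first by coords; ring.
  case: bE => tU1 tU3.
  rewrite /= EB EC oneP_brE /two_map /two_br; coords.
  - transitivity ((w.1 * z.2 + w.2 * z.1) * (t * U1)); first by ring.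
    by rewrite tU1; ring.
  - by ring.
  - transitivity ((w.1 * z.2 + w.2 * z.1) * (t * U3)); first by ring.
    by rewrite tU3 /D; char2_ring hk.
have [t0 | tn0] := eqVneq t 0.
  exists 1, 0, 0, 1; rewrite mul1r mul0r addr0 oner_neq0 t0 !mul0r; split=> //.
  by congr (_, _); apply/esym/eqP; rewrite mul1r bt t0.
have bn0 : b != 0 by rewrite bt.
(* The axes are sent to y' and to (t / b) x. *)
exists 0, 1, (t / b), 0; rewrite !mul0r mul1r add0r !mulr0 mulr1 divfK //.
by rewrite mulf_neq0 ?invr_eq0.
Qed.

Lemma is_subalg_one (r : oneP_row k) : is_subalg (rowA hk r) (smallA hk sOne).
Proof.
have l : linear (fun s : oneO k => (s, 0) : onePO k) by move=> ? ? ?; coords; ring.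
exists (lin l); split; last by move=> ? ? [].
by split=> [z|w z]; rewrite /= ?/zero_br; coords; ring.
Qed.

(** * Quotients *)

Definition three_map (W : lmodType k) (X Y Y' : W) (z : k^o * (k^o * k^o)) : W :=
  z.1 *: X + z.2.1 *: Y + z.2.2 *: Y'.

Lemma three_map_linear (W : lmodType k) (X Y Y' : W) : linear (three_map X Y Y').
Proof.
move=> a p q; rewrite /three_map /= !scalerDl !scalerDr !scalerA.
by rewrite [RHS]addrACA; congr (_ + _); exact: addrACA.
Qed.

Lemma three_mapE (W : lmodType k) (f : {linear (k^o * (k^o * k^o))%type -> W}) z :
  f z = three_map (f (e_x k)) (f (e_y k)) (f (e_y' k)) z.
Proof. by rewrite {1}[z]onePO_expand /three_map !linearD !linearZZ. Qed.

(** A surjection to P kills one line x + s y' (so x maps to s y' in characteristic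
    2). The second equation says that T preserves this line. Modulo the line,
    [y, y] = (e s + f) y' and [y', y] = (g s + h) y', and rescaling y adjusts
    these coefficients, at most one of which is nonzero, to u and v. *)
Lemma is_quot_P (p : consts k) (u v : k) (L A : lieAlg k) :
  u * v = 0 ->
  has_bracket (V := onePO k) (oneP_br (consts_brackets p)) L ->
  has_bracket (V := PO k) (P_br (0, u) (0, v)) A ->
  is_quot L A <-> let: Consts a b c e f g h := p in
    exists s, [/\ b = 0, a * s + c = s * (g * s + h),
      (e * s + f == 0) = (u == 0) & (g * s + h == 0) = (v == 0)].
Proof.
move=> uv0 [B ? ? ? ? ? ? EB] [C ? ? ? ? ? ? EC].
case: p EB => a b c e f g h EB; split.
  move=> [F [[Fd Fb] Fsurj]]; rewrite /= in F Fd Fb Fsurj *.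
  have FY' : F (e_y' k) = v4_d (PO k) (F (e_y k)) by rewrite -Fd.
  have FX : v4_d (PO k) (F (e_x k)) = 0 by rewrite -Fd (linear0 F).
  case EX: (F (e_x k)) FX => [s0 si] /= [s00]; subst s0.
  case EY: (F (e_y k)) FY' => [de ep] FY'.
  have FE z : F z = (de * z.2.1, si * z.1 + ep * z.2.1 + de * z.2.2).
    by rewrite three_mapE EX EY FY'; coords; ring.
  have de0 : de != 0.
    apply/eqP => de0; have [z] := Fsurj (1, 0).
    by rewrite FE de0 mul0r => -[/eqP]; rewrite eq_sym oner_eq0.
  have := Fb (e_x k) (e_y' k); have := Fb (e_x k) (e_y k).
  have := Fb (e_y k) (e_y k); have := Fb (e_y' k) (e_y k).
  rewrite !FE EB EB EB EB EC EC EC EC !oneP_brE !P_brE /=.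
  rewrite !(mulr0, mul0r, addr0, add0r, mulr1, mul1r, mulrC_pchar2 hk).
  move=> [vE] [uE] [_ xE] [bE].
  have {}bE : b = 0 by apply/(mulfI de0); rewrite bE mulr0.
  exists (si / de).
  have uE' : e * (si / de) + f = de * u.
    by apply/(mulfI de0); rewrite [RHS]mulrA -uE; field.
  have vE' : g * (si / de) + h = de * v.
    by apply/(mulfI de0); rewrite [RHS]mulrA -vE; field.
  split=> //; rewrite ?uE' ?vE' ?mulf_neq0E //.
  apply/(mulfI de0); transitivity (si * a + ep * b + de * c); last by rewrite xE; field.
  by rewrite bE; field.
move=> [s [b0 sE uE vE]].
have [de [de0 {}uE {}vE]] : exists de, [/\ de != 0, e * s + f = de * u & g * s + h = de * v].
  have [u0 | un0] := eqVneq u 0; last first.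
    have v0 : v = 0 by exact: (mulf_eq0_r uv0).
    exists ((e * s + f) / u); split; first by rewrite mulf_neq0 ?invr_eq0 // uE.
      by rewrite divfK.
    by rewrite v0 mulr0; apply/eqP; rewrite vE v0.
  have [v0 | vn0] := eqVneq v 0; last first.
    exists ((g * s + h) / v); split; first by rewrite mulf_neq0 ?invr_eq0 // vE.
      by rewrite u0 mulr0; apply/eqP; rewrite uE u0.
    by rewrite divfK.
  exists 1; rewrite oner_neq0 u0 v0 mulr0; split=> //; apply/eqP.
    by rewrite uE u0.
  by rewrite vE v0.
exists (lin (three_map_linear ((0, s * de) : PO k) (de, 0) (0, de))); split; last first.
  move=> [w1 w2]; exists (0, (w1 / de, w2 / de)); coords; by field.
split=> [z|w z]; first by coords; ring.
rewrite vE in sE.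
rewrite /= EB EC oneP_brE P_brE b0; coords; first by ring.
transitivity (de * ((w.1 * z.2.1 + w.2.1 * z.1) * (a * s + c)
  + w.2.1 * z.2.1 * (e * s + f) + (w.2.2 * z.2.1 + w.2.1 * z.2.2) * (g * s + h))).
  by ring.
by rewrite sE uE vE; char2_ring hk.
Qed.

(** The images X, Y of x, y are independent and y' maps to 0. Hence
    e X = [Y, Y] = 0 and g X = 0, and [X, Y] = a X + b Y, which vanishes if and
    only if a = b = 0. *)
Lemma is_quot_two (p : consts k) (t : k) (L A : lieAlg k) :
  has_bracket (V := onePO k) (oneP_br (consts_brackets p)) L ->
  has_bracket (V := twoO k) (two_br (t, 0)) A ->
  is_quot L A <-> let: Consts a b c e f g h := p in
    [&& e == 0, g == 0 & ((a == 0) && (b == 0)) == (t == 0)].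
Proof.
move=> [B ? ? ? ? ? ? EB] [C ? ? ? ? ? ? EC].
case: p EB => a b c e f g h EB; split.
  move=> [F [[Fd Fb] Fsurj]]; rewrite /= in F Fd Fb Fsurj *.
  have FY' : F (e_y' k) = 0.
    have -> : e_y' k = v4_d (onePO k) (e_y k) by [].
    by rewrite Fd.
  case EX: (F (e_x k)) => [X1 X2]; case EY: (F (e_y k)) => [Y1 Y2].
  have FE z : F z = (X1 * z.1 + Y1 * z.2.1, X2 * z.1 + Y2 * z.2.1).
    by rewrite three_mapE EX EY FY'; coords; ring.
  set D := X1 * Y2 + X2 * Y1.
  have D0 : D != 0.
    have [[u1 [u2 u3]]] := Fsurj (1, 0); have [[w1 [w2 w3]]] := Fsurj (0, 1).
    rewrite !FE /= => -[w10 w21] [u11 u20].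
    have DE : D * (u1 * w2 + u2 * w1) = 1.
      transitivity ((X1 * u1 + Y1 * u2) * (X2 * w1 + Y2 * w2)
        + (X1 * w1 + Y1 * w2) * (X2 * u1 + Y2 * u2)).
        by rewrite /D; char2_ring hk.
      by rewrite w10 w21 u11 u20 mul1r mul0r addr0.
    by apply/eqP => D0; move/eqP: DE; rewrite D0 mul0r eq_sym oner_eq0.
  have := Fb (e_x k) (e_y k); have := Fb (e_y k) (e_y k); have := Fb (e_y' k) (e_y k).
  rewrite !FE EB EB EB EC EC EC !oneP_brE !two_brE /=.
  rewrite !(mulr0, mul0r, addr0, add0r, mulr1, mul1r, mulrC_pchar2 hk).
  move=> [gX1 gX2] [eX1 eX2] [xE1 xE2].
  (* Cramer's rule for a X + b Y = D t (1, 0), where D is the determinant. *)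
  have aE : a = t * Y2.
    apply: (mulfI D0); transitivity ((X1 * a + Y1 * b) * Y2 + (X2 * a + Y2 * b) * Y1).
      by rewrite /D; char2_ring hk.
    by rewrite xE1 xE2 -/D; ring.
  have bE : b = t * X2.
    apply: (mulfI D0); transitivity ((X1 * a + Y1 * b) * X2 + (X2 * a + Y2 * b) * X1).
      by rewrite /D; char2_ring hk.
    by rewrite xE1 xE2 -/D; ring.
  apply/and3P; split.
  - apply/eqP/(mulfI D0); rewrite mulr0; transitivity (X1 * e * Y2 + X2 * e * Y1).
      by rewrite /D; ring.
    by rewrite eX1 eX2 !mul0r addr0.
  - apply/eqP/(mulfI D0); rewrite mulr0; transitivity (X1 * g * Y2 + X2 * g * Y1).
      by rewrite /D; ring.
    by rewrite gX1 gX2 !mul0r addr0.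
  apply/eqP; have [t0 | tn0] := eqVneq t 0; first by rewrite aE bE t0 !mul0r eqxx.
  rewrite aE bE !mulf_neq0E //; apply: contraNF D0 => /andP[/eqP Y20 /eqP X20].
  by rewrite /D Y20 X20 mulr0 mul0r addr0.
move=> /and3P[/eqP e0 /eqP g0 /eqP abt]; subst e g.
suff [X1 [X2 [Y1 [Y2 [D0 aE bE]]]]] : exists X1 X2 Y1 Y2 : k,
    [/\ X1 * Y2 + X2 * Y1 != 0, a = t * Y2 & b = t * X2].
  set D := X1 * Y2 + X2 * Y1 in D0.
  exists (lin (three_map_linear ((X1, X2) : twoO k) (Y1, Y2) 0)); split; last first.
    have [i Di] : exists i, D * i = 1 by exists D^-1; rewrite divff.
    move=> [w1 w2]; exists ((w1 * Y2 + w2 * Y1) * i, ((w1 * X2 + w2 * X1) * i, 0)).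
    by coords; rewrite -[RHS]mulr1 -Di /D; char2_ring hk.
  split=> [z|w z]; first by coords; ring.
  by rewrite /= EB EC oneP_brE aE bE /two_br; coords; char2_ring hk.
have [t0 | tn0] := eqVneq t 0.
  move: abt; rewrite t0 eqxx => /andP[/eqP a0 /eqP b0].
  exists 1, 0, 0, 1; rewrite a0 b0 !mul0r mul1r addr0; split=> //; exact: oner_neq0.
have [a0 | an0] := eqVneq a 0; last first.
  exists 1, (b / t), 0, (a / t); rewrite mulr0 addr0 mul1r; split.
  - by rewrite mulf_neq0 ?invr_eq0.
  - by field.
  - by field.
have bn0 : b != 0 by move: abt; rewrite a0 eqxx /= (negPf tn0) => ->.
exists 0, (b / t), 1, 0; rewrite mulr0 add0r mulr1; split.
- by rewrite mulf_neq0 ?invr_eq0.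
- by rewrite a0 mulr0.
- by field.
Qed.

Lemma is_quot_one (p : consts k) (L : lieAlg k) :
  has_bracket (V := onePO k) (oneP_br (consts_brackets p)) L ->
  xy_y p = 0 -> is_quot L (smallA hk sOne).
Proof.
move=> [B ? ? ? ? ? ? EB]; case: p EB => a b c e f g h EB /= b0.
have l : linear (fun z : onePO k => z.2.1 : oneO k) by move=> ? ? ?; coords; ring.
exists (lin l); split; last by move=> s; exists (0, (s, 0)).
by split=> [z|w z] //=; rewrite EB oneP_brE b0 /= mulr0.
Qed.

End Char2.

(** * The tables *)

Section Char2.
Variables (k : fieldType) (hk : 2%N \in [pchar k]).

(** The abstract algebras A over which the definition quantifies are exchanged for
    the finitely many listed ones. *)
Lemma occur_exactlyP (occurs : lieAlg k -> Prop) (t : seq small) :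
  (forall A B, lie_iso A B -> occurs A -> occurs B) ->
  (sOne \in t -> occurs (smallA hk sOne)) ->
  (forall s, s != sOne -> occurs (smallA hk s) <-> s \in t) ->
  occur_exactly hk occurs t.
Proof.
move=> occ_iso occ1 occP; split=> [s st | A AV occA].
  by have [s1 | sn1] := eqVneq s sOne; [rewrite s1 in st *; exact: occ1 | exact/(occP _ sn1)].
suff [s sn1 As] : exists2 s, s != sOne & lie_iso A (smallA hk s).
  by exists s => //; apply/(occP _ sn1)/(occ_iso _ _ As).
by case: AV => [/(classify_P hk)|/(classify_two hk)] [s sP As]; exists s => //; case: s sP {As}.
Qed.

Lemma jacobi_row (r : oneP_row k) : jacobi_consts (row_consts r).
Proof. by case: r => *; split; ring. Qed.

Lemma P_consts_mul s : (P_consts k s).1 * (P_consts k s).2 = 0.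
Proof. by case: s; rewrite /= ?mulr0 ?mul0r. Qed.

Lemma small_cases s : s != sOne -> s \in [:: sPa; sPs; sPn] \/ s \in [:: sOne2; sL2].
Proof. by case: s => // _; [right|right|left|left|left]. Qed.

Lemma sub_tableP (r : oneP_row k) s : s != sOne ->
  is_subalg (rowA hk r) (smallA hk s) <-> s \in sub_table r.
Proof.
case/small_cases=> sP.
  rewrite (is_subalg_P hk (jacobi_row r) (P_consts_mul s) (row_bracket hk r)
    (smallA_P hk sP)).
  by case: r => [|l|l||l|l||||l|l||]; case: s sP; rewrite //= ?(eqxx, oner_eq0).
rewrite (is_subalg_two hk (row_bracket hk r) (smallA_two hk sP)).
by case: r => [|l|l||l|l||||l|l||]; case: s sP => // _;
  rewrite /two_const /= ?(eqxx, oner_eq0).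
Qed.

End Char2.

Local Ltac simpg :=
  rewrite /= ?(mul0r, mulr0, mul1r, mulr1, add0r, addr0, eqxx, oner_eq0).

(** On 2.1 the criterion is boolean and computes. On P, each row leaves an equation
    for the parameter s of the killed line x + s y', denoted by z below. For the
    eleventh row it is z ^ 2 = z + l, which has a solution since k is
    algebraically closed. *)
Lemma quot_tableP (k : closedFieldType) (hk : 2%N \in [pchar k]) (r : oneP_row k) s :
  s != sOne -> is_quot (rowA hk r) (smallA hk s) <-> s \in quot_table r.
Proof.
case/small_cases=> sP; last first.
  rewrite (is_quot_two hk (row_bracket hk r) (smallA_two hk sP)).
  by case: r => [|l|l||l|l||||l|l||]; case: s sP => // _;
    rewrite /two_const /= ?(eqxx, oner_eq0) //=; case: (l == 0) => //=.
rewrite (is_quot_P hk (P_consts_mul k s) (row_bracket hk r) (smallA_P hk sP)).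
have N1 : (1 == 0 :> k) = false by rewrite oner_eq0.
(* The quotient is read off from the vanishing of its two constants. *)
have in_cases (z1 z2 : bool) : z1 = ((P_consts k s).1 == 0) ->
    z2 = ((P_consts k s).2 == 0) -> s = if ~~ z1 then sPn else if ~~ z2 then sPs else sPa.
  by move=> -> ->; case: s sP => //=; rewrite ?(N1, eqxx).
case: r => [|l|l||l|l||||l|l||]; rewrite /=; split=> [[z [bE zE]] | sT].
(* Two goals for each row, in order: from z to the table, and a z for each entry. *)
- by rewrite !mul0r !addr0 eqxx => /in_cases h /h ->.
- by case: s {in_cases} sP sT => // _ _; exists 0; split; simpg.
- by move/eqP: bE; rewrite N1.
- by case: s {in_cases} sP sT.
- by rewrite !mul0r add0r addr0 N1 => /in_cases h /h ->.
- exists 0; case: s {in_cases} sP sT => // _; rewrite ?inE; case: (l == 0) => // _; split; by simpg.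
- by move/eqP: zE; simpg.
- by case: s {in_cases} sP sT.
(* Fifth row: z (l z) = 0, so that a nonzero z forces l = 0. *)
- rewrite mul1r !addr0 => /in_cases h /h ->; have [z0|zn0] /= := eqVneq z 0.
    by rewrite z0 mulr0 eqxx; case: ifP.
  by move/eqP: zE; rewrite !(mul0r, addr0) eq_sym !mulf_eq0 (negPf zn0) /= orbF => ->.
- case: (eqVneq l 0) sT => [-> | ln0] sT.
    by case: s {in_cases} sP sT => // _ _; [exists 0 | exists 1]; split; simpg.
  by case: s {in_cases} sP sT => // _ _; exists 0; split; simpg.
(* Sixth row: z (l z + 1) = 0. *)
- rewrite mul1r addr0 => /in_cases h /h ->; have [z0|zn0] /= := eqVneq z 0.
    by rewrite z0 mulr0 add0r N1; case: ifP.
  move/eqP: zE; rewrite !(mul0r, addr0) eq_sym mulf_eq0 (negPf zn0) /= => lz.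
  by case: (eqVneq l 0) lz => // ->; rewrite mul0r add0r N1.
- case: (eqVneq l 0) sT => [-> | ln0] sT.
    by case: s {in_cases} sP sT => // _ _; exists 0; split; simpg.
  case: s {in_cases} sP sT => // _ _; [exists 0 | exists l^-1].
    by split; simpg.
  have lz : l / l + 1 = 0 by rewrite divff // (addrr_pchar2 hk).
  by split; rewrite ?lz; simpg; rewrite ?invr_eq0 ?(negPf ln0).
- by rewrite !mul0r !addr0 eqxx => /in_cases h /h ->.
- by case: s {in_cases} sP sT => // _ _; exists 0; split; simpg.
- by move/eqP: zE; simpg.
- by case: s {in_cases} sP sT.
- move/eqP: zE; rewrite mul1r mul0r add0r mulr1 -{2}[z]addr0 (inj_eq (addrI z)).
  by rewrite N1.
- by case: s {in_cases} sP sT.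
- rewrite !mul0r !(addr0, add0r) N1 eqxx => /in_cases h /h ->.
  by rewrite !inE orbT.
- exists 0; case: s {in_cases} sP sT => // _; rewrite ?inE; case: (l == 0) => // _; split; by simpg.
- rewrite mul0r addr0 eqxx mul1r addr0 => /in_cases h /h ->.
  case: (eqVneq l 0) => l0; have [z0|zn0] := eqVneq z 0 => //.
  by move: zE; rewrite z0; simpg => lE; rewrite lE eqxx in l0.
- case: (eqVneq l 0) sT => [-> | ln0] sT.
    by case: s {in_cases} sP sT => // _ _; [exists 0 | exists 1]; split; simpg.
  have [z zE] := @solve_monicpoly k 2 (fun i => if i == 0 then l else 1) isT.
  rewrite big_ord_recl big_ord1 /= expr0 mulr1 mul1r expr1 addrC expr2 in zE.
  case: s {in_cases} sP sT => // _ _; exists z; split; simpg => //.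
  by apply: contraNF ln0 => /eqP z0; move/eqP: zE; rewrite z0; simpg; rewrite eq_sym.
- rewrite mul0r addr0 eqxx mul1r addr0 => /in_cases h /h ->.
  have [z0|//] := eqVneq z 0.
  by move/eqP: zE; rewrite z0; simpg.
- by case: s {in_cases} sP sT => // _ _; exists 1; split; simpg.
- rewrite mul0r addr0 eqxx mul1r addr0 => /in_cases h /h ->.
  move/eqP: zE; simpg; rewrite eq_sym mulf_eq0 orbb => /eqP ->.
  by rewrite eqxx.
- by case: s {in_cases} sP sT => // _ _; exists 0; split; simpg.
Qed.

Theorem proposition4p13 (k : closedFieldType) (hk : 2%N \in [pchar k]) :
  (forall L : lieAlg k, v4_iso L (onePO k) ->
     exists! r : oneP_row k, lie_iso L (rowA hk r)) /\
  (forall r : oneP_row k,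
     occur_exactly hk (is_subalg (rowA hk r)) (sub_table r) /\
     occur_exactly hk (is_quot (rowA hk r)) (quot_table r)).
Proof.
split=> [L|r]; first exact: classification.
split; apply: occur_exactlyP => [A B||s].
- exact: is_subalg_iso.
- by move=> _; apply: is_subalg_one.
- exact: sub_tableP.
- exact: is_quot_iso.
- move=> one_in; apply: (is_quot_one hk (row_bracket hk r)).
  by case: r one_in.
- exact: quot_tableP.
Qed.
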